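(* Let $p$ be a probability density on $\mathbb{R}^d$ such that (i) $p$ is log-concave and $p(x)>0$ for all $x\in\mathbb{R}^d$, and (ii) $p$ is three times differentiable and $M:=\sup_{x\in\mathbb{R}^d}\|\nabla^3 \ln p(x)\|_F<\infty$. Let $\tau>0$ and $y\in\mathbb{R}^d$, and let $x^\star:=\mathrm{prox}_{-\tau\ln p}(y)$. Define the iterates $x_0=y$ and, for $k\ge 0$, $$x_{k+1}=\alpha_k\,\mathrm{MMSE}_{\sigma_k}(x_k)+(1-\alpha_k)\,y,\qquad \alpha_k=\frac{k+1}{k+2},\quad \sigma_k^2=\frac{\tau}{k+1}.$$ Then for all $k\ge 1$, $$\|x_k-x^\star\|\le \frac{\ln k+7}{k+1}\Big[\|y-x^\star\|+\tau^2 M\sqrt{d}\Big].$$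
   Context: For $\sigma>0$, $p_\sigma$ denotes the density of $X+\sigma\varepsilon$ where $X\sim p$ and $\varepsilon\sim\mathcal N(0,I_d)$ are independent (the convolution of $p$ with a centred Gaussian of covariance $\sigma^2 I_d$). The MMSE denoiser is $\mathrm{MMSE}_\sigma(z):=\mathbb{E}[X\mid X+\sigma\varepsilon=z]$. For a tensor $A\in\mathbb{R}^{d\times d\times d}$, $\|A\|_F=(\sum_{i,j,k}A_{ijk}^2)^{1/2}$. The proximal point is $\mathrm{prox}_{-\tau\ln p}(y):=\arg\min_{x\in\mathbb{R}^d}\big\{\tfrac12\|y-x\|^2-\tau\ln p(x)\big\}$, which is unique since this objective is $1$-strongly convex. *)

(* Defs.v *)
From HB Require Import structures.
From mathcomp Require Import all_boot all_order all_algebra.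
From mathcomp Require Import all_classical all_reals all_analysis.
Set Implicit Arguments. Unset Strict Implicit. Unset Printing Implicit Defensive.
Import Order.TTheory GRing.Theory Num.Theory.
Import numFieldNormedType.Exports.
Local Open Scope classical_set_scope.
Local Open Scope ring_scope.

Section Defs.
Variable R : realType.

Definition enorm (d : nat) (v : 'rV[R]_d) : R :=
  Num.sqrt (\sum_(i < d) v 0 i ^+ 2).

(* Lebesgue integral over R^d of a nonnegative function, as iterated
   one-dimensional Lebesgue integrals (= product-measure integral by Tonelli) *)
Fixpoint iintE (d : nat) : ('rV[R]_d -> R) -> \bar R :=
  match d with
  | 0 => fun f => (f 0)%:E
  | d'.+1 => fun f =>
      (\int[@lebesgue_measure R]_t
         iintE (fun v : 'rV[R]_d' => f (row_mx (\row_(j < 1) t) v)))%E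
  end.

Definition iint (d : nat) (f : 'rV[R]_d -> R) : R :=
  fine (iintE (fun x => Num.max (f x) 0%R) - iintE (fun x => Num.max (- f x)%R 0%R))%E.


Variable d : nat.

Definition gauss (s : R) (u : 'rV[R]_d) : R :=
  (Num.sqrt (2 * pi * s ^+ 2))^-1 ^+ d * expR (- (enorm u ^+ 2) / (2 * s ^+ 2)).

Definition psmooth (p : 'rV[R]_d -> R) (s : R) (z : 'rV[R]_d) : R :=
  iint (fun x => p x * gauss s (z - x)).

(* MMSE_sigma(z) = E[X | X + sigma eps = z]
   = (int x p(x) gauss_sigma(z - x) dx) / p_sigma(z)  (posterior mean) *)
Definition mmse (p : 'rV[R]_d -> R) (s : R) (z : 'rV[R]_d) : 'rV[R]_d :=
  \row_(i < d) (iint (fun x => x 0 i * (p x * gauss s (z - x))) / psmooth p s z).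

Definition evec (i : 'I_d) : 'rV[R]_d := delta_mx 0 i.

Definition thrice_differentiable (p : 'rV[R]_d -> R) : Prop :=
  [/\ forall x, differentiable p x,
      forall i x, differentiable ('D_(evec i) p) x &
      forall i j x, differentiable ('D_(evec i) ('D_(evec j) p)) x].

Definition D3 (f : 'rV[R]_d -> R) (x : 'rV[R]_d) (i j k : 'I_d) : R :=
  'D_(evec i) ('D_(evec j) ('D_(evec k) f)) x.

Definition frob3_lnp (p : 'rV[R]_d -> R) (x : 'rV[R]_d) : R :=
  Num.sqrt (\sum_(i < d) \sum_(j < d) \sum_(k < d) D3 ((@ln R) \o p) x i j k ^+ 2).

Definition log_concave (p : 'rV[R]_d -> R) : Prop :=
  forall (x y : 'rV[R]_d) (t : R), 0 <= t <= 1 ->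
    t * ln (p x) + (1 - t) * ln (p y) <= ln (p (t *: x + (1 - t) *: y)).

Definition is_prox (p : 'rV[R]_d -> R) (tau : R) (y xs : 'rV[R]_d) : Prop :=
  forall x : 'rV[R]_d,
    2^-1 * enorm (y - xs) ^+ 2 - tau * ln (p xs)
    <= 2^-1 * enorm (y - x) ^+ 2 - tau * ln (p x).

Definition alpha (k : nat) : R := k.+1%:R / k.+2%:R.
Definition sigma (tau : R) (k : nat) : R := Num.sqrt (tau / k.+1%:R).

Fixpoint iterate (p : 'rV[R]_d -> R) (tau : R) (y : 'rV[R]_d) (k : nat)
    : 'rV[R]_d :=
  match k with
  | 0 => y
  | k'.+1 => alpha k' *: mmse p (sigma tau k') (iterate p tau y k')
             + (1 - alpha k') *: y
  end.

End Defs.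

(* Main.v *)
Require Import Defs.
From HB Require Import structures.
From mathcomp Require Import all_boot all_order all_algebra.
From mathcomp Require Import all_classical all_reals all_analysis.
From mathcomp Require Import measurable_realfun zify ring lra.
Import Order.TTheory GRing.Theory Num.Theory.
Import numFieldNormedType.Exports.
Local Open Scope classical_set_scope.
Local Open Scope ring_scope.
Set Implicit Arguments. Unset Strict Implicit. Unset Printing Implicit Defensive.

(** Write [L = ln p], [g = grad L], and let [m_s z] be the mean of the weight
    [w_z x = p x * gauss s (z - x)], that is, [mmse p s z].  The points
    [z_k = xstar + (y - xstar) / (k + 1) = xstar - sigma_k ^ 2 g(xstar)] satisfy
    [z_(k+1) = alpha_k xstar + (1 - alpha_k) y], so the recursion for
    [(k + 1) |x_k - z_k|] closes, with a harmonic sum, as soon as [m_s] is nonexpansive and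
    [|m_s (x0 - s^2 g x0) - x0| <= s^4 M sqrt d].

    Nonexpansiveness: by Jensen, [z |-> s^2 ln (int w_z) + |z|^2 / 2] is convex with subgradient
    [m_s]; by Prekopa-Leindler, [ln (int w_z)] is concave; both together make [m_s] cocoercive.

    Second estimate: integrating the score of [w_z] gives [E g = (m - z) / s^2], and since [g] is
    monotone it remains to bound [E h - h m] for [h = <g, w>].  Interpolating between [m] and [x]
    turns it into covariances of the partial derivatives of [h] with the coordinates, which
    a Poincare inequality for [w_z] controls; that inequality is obtained from
    Prekopa-Leindler by a small perturbation.  Its constant is twice the optimal one, which the
    factor [1/2] of the interpolation just absorbs. *)

(** Third derivatives of [ln p] exist and are bounded but need not be continuous, so they are never
    integrated. They enter as Lipschitz constants of second derivatives, by the mean value theorem,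
    and through a pointwise bound on their squares. Hence the Poincare inequality is stated for a
    whole family of functions, with a uniform bound on the summed squared gradients on its right
    side. Likewise [int w_z] is never differentiated in [z]: its convexity and concavity are
    inequalities between integrals, the score identity comes from translation invariance, and the
    interpolation integral is a limit of Riemann sums.

    The factor [sqrt d] comes from Cauchy-Schwarz over the coordinates: their summed variances are
    at most [2 s ^ 2 d], those of the partial derivatives of [h] at most [2 s ^ 2 |w| ^ 2 M ^ 2].
    The Hessian of [h] contracts one index of the third derivative with [w], which is where the
    Frobenius norm fits. *)

(** * Primitives of integrable functions on the line *)

Section OneDim.
Variable R : realType.
Local Notation mu := (@lebesgue_measure R).
Implicit Types f a b c : R -> R.

Lemma is_derive_within (f df : R -> R) (A : set R) :
  (forall t : R, is_derive t 1 f (df t)) -> {within A, continuous f}.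
Proof.
move=> fd; apply: continuous_subspaceT => t.
by apply/differentiable_continuous/derivable1_diffP; apply: ex_derive.
Qed.

Lemma derive_le (f df : R -> R) (x y : R) :
  (forall t : R, is_derive t 1 f (df t)) -> (forall t, 0 <= df t) ->
  x <= y -> f x <= f y.
Proof.
move=> fd df0 xy.
have [c _ e] := @MVT_segment R f df x y xy (fun t _ => fd t) (is_derive_within fd).
by rewrite -subr_ge0 e mulr_ge0 ?subr_ge0.
Qed.

Lemma derive_lt (f df : R -> R) (x y : R) :
  (forall t : R, is_derive t 1 f (df t)) -> (forall t, 0 < df t) ->
  x < y -> f x < f y.
Proof.
move=> fd df0 xy.
have [c _ e] := @MVT_segment R f df x y (ltW xy) (fun t _ => fd t) (is_derive_within fd).
by rewrite -subr_gt0 e mulr_gt0 ?subr_gt0.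
Qed.

Definition cum f (x : R) : R := \int[mu]_(t in `]-oo, x]) f t.

Variable f : R -> R.
Hypothesis fc : continuous f.
Hypothesis fi : mu.-integrable setT (EFin \o f).

Lemma cum_derive (x : R) : is_derive x 1 (cum f) (f x).
Proof.
have xu : x < x + 1 by rewrite ltrDl.
have fiu : mu.-integrable [set` Interval -oo%O (BRight (x + 1))] (EFin \o f).
  by apply: integrableS fi.
have [d e] := continuous_FTC1 xu fiu (ltNyr _) (@fc x).
by apply: DeriveDef d _; rewrite -derive1E.
Qed.

(** Covers both ends at once: [A] is the limit of the half-lines, either the whole line or the empty
    set, and [|f|] dominates. *)
Lemma cum_cvg (u : nat -> R) (A : set R) : measurable A ->
  (forall t, \1_(`]-oo, u n]%classic) t @[n --> \oo] --> (\1_A t : R)) ->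
  cum f (u n) @[n --> \oo] --> \int[mu]_(t in A) f t.
Proof.
move=> mA uA.
have mf : measurable_fun setT f by exact: continuous_measurable_fun.
have mfB (B : set R) : measurable B -> measurable_fun setT (f \_ B).
  move=> mB; apply: (iffLR (measurable_restrictT f mB)).
  by apply: measurable_funS mf.
have H := @dominated_convergence _ _ R mu setT measurableT
  (fun n => EFin \o (f \_ `]-oo, u n]%classic)) (EFin \o (f \_ A)) (abse \o (EFin \o f)).
have [||||| _ _ K] := H.
- by move=> n; apply/measurable_EFinP; exact: mfB.
- by apply/measurable_EFinP; exact: mfB.
- apply: aeW => t _ /=; apply: cvg_EFin; first exact: nearW.
  have E (B : set R) : (f \_ B) t = f t * \1_B t by rewrite patch_indic.
  rewrite E (eq_cvg _ _ (fun n => E `]-oo, u n]%classic)).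
  by apply: cvgM; [exact: cvg_cst|exact: uA].
- exact: integrable_abse.
- apply: aeW => t n _ /=; rewrite lee_fin patch_indic /= normrM ler_piMr//.
  by rewrite indicE; case: (_ \in _); rewrite ?normr1 ?normr0.
have iA (B : set R) : measurable B -> mu.-integrable setT (EFin \o (f \_ B)).
  move=> mB; rewrite -restrict_EFin; apply/integrable_restrict => //.
  by rewrite setTI; exact: integrableS fi.
rewrite Rintegral_mkcond; apply: fine_cvg.
rewrite fineK; last by apply: integrable_fin_num => //; exact: iA.
apply: cvg_trans K; apply: near_eq_cvg; near=> n => /=.
by rewrite [RHS]integral_mkcond restrict_EFin.
Unshelve. all: end_near. Qed.

Lemma cum_pinfty : cum f n%:R @[n --> \oo] --> \int[mu]_t f t.
Proof.
apply: cum_cvg => // t; apply: cvg_near_cst; near=> n.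
rewrite !indicE in_setT mem_set//= in_itv /=.
by near: n; exact: nbhs_infty_ger.
Unshelve. all: end_near. Qed.

Lemma cum_ninfty : cum f (- n%:R) @[n --> \oo] --> (0 : R).
Proof.
rewrite -(Rintegral_set0 mu f).
apply: cum_cvg => // t; apply: cvg_near_cst; near=> n.
rewrite !indicE in_set0 memNset//= in_itv /=; apply/negP; rewrite -ltNge ltrNl.
by near: n; exact: nbhs_infty_gtr.
Unshelve. all: end_near. Qed.

Hypothesis f0 : forall t, 0 < f t.

Lemma cum_lt (x y : R) : x < y -> cum f x < cum f y.
Proof. exact: derive_lt cum_derive f0. Qed.

Lemma cum_gt0 (x : R) : 0 < cum f x.
Proof.
apply: (@le_lt_trans _ _ (cum f (x - 1))); last by apply: cum_lt; rewrite gtrDl oppr_lt0.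
by apply: Rintegral_ge0 => t _; exact: ltW.
Qed.

Lemma cum_lt_int (x : R) : cum f x < \int[mu]_t f t.
Proof.
apply: (@lt_le_trans _ _ (cum f (x + 1))); first by apply: cum_lt; rewrite ltrDl.
apply: cvgr_to_ge cum_pinfty _; near=> n.
have : x + 1 <= n%:R by near: n; exact: nbhs_infty_ger.
by rewrite le_eqVlt => /predU1P[<-//|/cum_lt/ltW].
Unshelve. all: end_near. Qed.

Lemma Rintegral_gt0 : 0 < \int[mu]_t f t.
Proof. exact: lt_trans (cum_gt0 0) (cum_lt_int 0). Qed.

Lemma cum_onto (v : R) : 0 < v < \int[mu]_t f t -> exists x, cum f x = v.
Proof.
move=> /andP[v0 vf].
have [n Hn] : exists n : nat, cum f (- n%:R) < v /\ v < cum f n%:R.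
  near \oo => n; exists n; split; near: n.
  - exact: (cvgr_lt _ cum_ninfty).
  - exact: (cvgr_gt _ cum_pinfty).
have le2 : - n%:R <= n%:R :> R by rewrite (le_trans (y := 0)) // oppr_le0.
have [|c _ <-] := IVT le2 (is_derive_within cum_derive) (v := v).
  by rewrite ge_min le_max (ltW Hn.1) (ltW Hn.2) orbT.
by exists c.
Unshelve. all: end_near. Qed.

Lemma cum_inj : injective (cum f).
Proof.
move=> x y e; apply/eqP; case: ltgtP => // /cum_lt; by rewrite e ltxx.
Qed.

Lemma cum_inverse : exists2 g : R -> R, cancel (cum f) g &
  forall v, 0 < v < \int[mu]_t f t -> cum f (g v) = v.
Proof.
pose g v := xget 0 [set x | cum f x = v].
exists g => [x|v /cum_onto[x xv]].
  apply: cum_inj; have : [set y | cum f y = cum f x] (g (cum f x)) by by apply: xgetPex; exists x.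
  by [].
by apply: (@xgetPex _ 0 [set x | cum f x = v]); exists x.
Qed.

End OneDim.

(** * The one-dimensional Prekopa-Leindler inequality, by monotone transport *)

Section PrekopaLeindler1.
Variable R : realType.
Local Notation mu := (@lebesgue_measure R).

(* Transporting [a] to [b] by [T], the map [x |-> (x + T x) / 2] pushes at least
   [sqrt (\int b / \int a) * a] below [c]. *)
Lemma prekopa_leindler1 (a b c : R -> R) :
  continuous a -> continuous b -> continuous c ->
  mu.-integrable setT (EFin \o a) -> mu.-integrable setT (EFin \o b) ->
  mu.-integrable setT (EFin \o c) ->
  (forall x, 0 < a x) -> (forall x, 0 < b x) -> (forall x, 0 < c x) ->
  (forall x y, a x * b y <= c (2^-1 * (x + y)) ^+ 2) ->
  (\int[mu]_t a t) * (\int[mu]_t b t) <= (\int[mu]_t c t) ^+ 2.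
Proof.
move=> ac bc cc ai bi ci a0 b0 c0 abc.
set A := \int[mu]_t a t; set B := \int[mu]_t b t; set C := \int[mu]_t c t.
have A0 : 0 < A by exact: Rintegral_gt0.
have B0 : 0 < B by exact: Rintegral_gt0.
have C0 : 0 < C by exact: Rintegral_gt0.
(* [k] rescales the mass of [a] to that of [b], so that [k * cum a x] is always a value of
   [cum b]. *)
pose k := B / A; have k0 : 0 < k by rewrite divr_gt0.
have [g gK Kg] := cum_inverse bc bi b0.
pose T x := g (k * cum a x).
have bT x : cum b (T x) = k * cum a x.
  apply: Kg; rewrite mulr_gt0 ?cum_gt0//= /k mulrAC ltr_pdivrMr// ltr_pM2l//.
  exact: cum_lt_int.
have dT x : is_derive (x : R) 1 T (k * a x / b (T x)).
  have dg : is_derive (k * cum a x) 1 g (b (T x))^-1.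
    rewrite -bT; apply: is_derive_inverse.
    - by near=> z; exact: gK.
    - near=> z; apply/differentiable_continuous/derivable1_diffP.
      by have [] := cum_derive bc bi z.
    - exact: cum_derive.
    - by rewrite gt_eqF.
  have dk : is_derive (x : R) 1 (fun x => k * cum a x) (k * a x).
    have := cum_derive ac ai x => d.
    by apply: is_derive_eq.
  by have := @is_derive1_comp _ g (fun x => k * cum a x) _ _ _ dg dk; rewrite mulrC.
pose S x := 2^-1 * (x + T x).
(* Monotonicity of [H] is the integrated form of [c (S x) * S' x >= sqrt k * a x]. *)
pose H x := cum c (S x) - Num.sqrt k * cum a x.
have dS x : is_derive (x : R) 1 S (2^-1 * (1 + k * a x / b (T x))).
  by have := dT x => d; apply: is_derive_eq.
have dH x : is_derive (x : R) 1 H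
    (c (S x) * (2^-1 * (1 + k * a x / b (T x))) - Num.sqrt k * a x).
  have d1 := @is_derive1_comp _ (cum c) S _ _ _ (cum_derive cc ci (S x)) (dS x).
  have d2 := cum_derive ac ai x.
  have d3 : is_derive (x : R) 1 (fun x => Num.sqrt k * cum a x) (Num.sqrt k * a x).
    by apply: is_derive_eq.
  exact: (is_deriveB d1 d3).
(* Arithmetic-geometric mean: with [u] the derivative of [T], [(1 + u) / 2 >= sqrt u], while
   [a x * b (T x) * u = k * a x ^ 2]. *)
have H0 x : 0 <= c (S x) * (2^-1 * (1 + k * a x / b (T x))) - Num.sqrt k * a x.
  set u := k * a x / b (T x).
  have u0 : 0 <= u by rewrite /u ltW// !mulr_gt0 ?invr_gt0.
  have au : a x * b (T x) * u = k * a x ^+ 2.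
    by rewrite /u; field; rewrite gt_eqF.
  have s1 : 0 <= Num.sqrt k * a x by rewrite mulr_ge0 ?sqrtr_ge0 ?ltW.
  have s2 : 0 <= c (S x) * (2^-1 * (1 + u)).
    by rewrite !mulr_ge0 ?addr_ge0 ?invr_ge0// ltW.
  rewrite subr_ge0 -(@ler_pXn2r _ 2)// !exprMn sqr_sqrtr; last exact: ltW.
  rewrite -au.
  apply: (@le_trans _ _ (c (S x) ^+ 2 * u)).
    by rewrite ler_wpM2r// abc.
  by rewrite ler_wpM2l ?sqr_ge0//; have := sqr_ge0 (u - 1); lra.
(* It does not matter whether [S] exhausts the line: every increment of [cum c] is at most [C]. *)
have HC n : Num.sqrt k * (cum a n%:R - cum a (- n%:R)) <= C.
  have nn : - n%:R <= n%:R :> R by rewrite (le_trans (y := 0)) // oppr_le0.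
  have h1 : H (- n%:R) <= H n%:R := derive_le dH H0 nn.
  have h2 : cum c (S n%:R) < C := cum_lt_int cc ci c0 (S n%:R).
  have h3 := cum_gt0 cc ci c0 (S (- n%:R)).
  rewrite mulrBr; move: h1 h2 h3; rewrite /H.
  move: (cum c (S n%:R)) (cum c (S (- n%:R))) (Num.sqrt k * cum a n%:R).
  by move: (Num.sqrt k * _) => u1 u2 u3 u4 h1 h2 h3; clearbody C; lra.
have AC : Num.sqrt k * A <= C.
  have H1 : Num.sqrt k * (cum a n%:R - cum a (- n%:R)) @[n --> \oo] --> Num.sqrt k * (A - 0).
    apply: cvgM; first exact: cvg_cst.
    apply: cvgB; [exact: cum_pinfty|exact: cum_ninfty].
  rewrite subr0 in H1; apply: cvgr_to_le H1 _; exact: nearW.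
have -> : A * B = (Num.sqrt k * A) ^+ 2.
  by rewrite exprMn sqr_sqrtr ?ltW// /k; field; rewrite gt_eqF.
by rewrite ler_pXn2r// nnegrE ?mulr_ge0 ?sqrtr_ge0// ltW.
Unshelve. all: end_near. Qed.

End PrekopaLeindler1.

(** * Sequential continuity on row vectors *)

Section SequentialContinuity.
Variable R : realType.

(** Coordinatewise sequences rather than a topology on row vectors: dominated convergence takes
    sequences, and freezing the first coordinate preserves the notion. *)
Definition cvg_coord d (u : nat -> 'rV[R]_d) (x : 'rV[R]_d) :=
  forall i, u n 0 i @[n --> \oo] --> x 0 i.

Definition scont d (F : 'rV[R]_d -> R) :=
  forall u x, cvg_coord u x -> F (u n) @[n --> \oo] --> F x.

(** The l1 norm is chosen because [expR (- norm1 x)] factors over the coordinates. *)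
Definition norm1 d (x : 'rV[R]_d) : R := \sum_(i < d) `|x 0 i|.

Definition cons_row d (t : R) (v : 'rV[R]_d) : 'rV[R]_d.+1 := row_mx (\row_(j < 1) t) v.

Lemma cons_row0 d t (v : 'rV[R]_d) (j : 'I_1) : cons_row t v 0 (lshift d j) = t.
Proof. by rewrite [LHS]row_mxEl mxE. Qed.

Lemma cons_rowS d t (v : 'rV[R]_d) j : cons_row t v 0 (rshift 1 j) = v 0 j.
Proof. by rewrite [LHS]row_mxEr. Qed.

Lemma cons_rowP d (x : 'rV[R]_d.+1) : exists t v, x = cons_row t v.
Proof.
exists (@lsubmx _ 1 1 d x 0 0), (@rsubmx _ 1 1 d x).
rewrite /cons_row (_ : \row_(j < 1) _ = @lsubmx _ 1 1 d x).
  by rewrite (@hsubmxK _ 1 1 d).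
by apply/matrixP => i j; rewrite mxE !ord1.
Qed.

Lemma cvg_cons_row d (t : nat -> R) s (v : nat -> 'rV[R]_d) w :
  t n @[n --> \oo] --> s -> cvg_coord v w ->
  cvg_coord (fun n => cons_row (t n) (v n)) (cons_row s w).
Proof.
move=> ts vw i; case: (@splitP 1 d i) => j ij.
- have -> : i = lshift d j by apply/val_inj.
  by rewrite cons_row0 (eq_cvg _ _ (fun n => cons_row0 (t n) (v n) j)).
- have -> : i = rshift 1 j by apply/val_inj.
  by rewrite cons_rowS (eq_cvg _ _ (fun n => cons_rowS (t n) (v n) j)); exact: vw.
Qed.

Lemma cvg_coord_cst d (v : 'rV[R]_d) : cvg_coord (fun=> v) v.
Proof. by move=> i; exact: cvg_cst. Qed.

Lemma norm1_cons d t (v : 'rV[R]_d) : norm1 (cons_row t v) = `|t| + norm1 v.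
Proof.
rewrite /norm1 (@big_split_ord _ _ _ 1 d) /= big_ord1 cons_row0; congr (_ + _).
by apply: eq_bigr => i _; rewrite cons_rowS.
Qed.

Lemma norm1_ge0 d (x : 'rV[R]_d) : 0 <= norm1 x.
Proof. exact: sumr_ge0. Qed.

Lemma norm1D d (x y : 'rV[R]_d) : norm1 (x + y) <= norm1 x + norm1 y.
Proof. by rewrite /norm1 -big_split ler_sum // => i _; rewrite mxE ler_normD. Qed.

Lemma norm1Z d a (x : 'rV[R]_d) : norm1 (a *: x) = `|a| * norm1 x.
Proof. by rewrite /norm1 mulr_sumr; apply: eq_bigr => i _; rewrite mxE normrM. Qed.

Lemma norm1_coord d (x : 'rV[R]_d) i : `|x 0 i| <= norm1 x.
Proof. by rewrite /norm1 (bigD1 i) //= lerDl sumr_ge0. Qed.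

Lemma scont_cst d (a : R) : scont (fun _ : 'rV[R]_d => a).
Proof. by move=> u x _; exact: cvg_cst. Qed.

Lemma scont_coord d i : scont (fun x : 'rV[R]_d => x 0 i).
Proof. by move=> u x; apply. Qed.

Lemma scontD d (F G : 'rV[R]_d -> R) : scont F -> scont G -> scont (fun x => F x + G x).
Proof. by move=> cF cG u x ux; apply: cvgD; [exact: cF|exact: cG]. Qed.

Lemma scontN d (F : 'rV[R]_d -> R) : scont F -> scont (fun x => - F x).
Proof. by move=> cF u x ux; apply: cvgN; exact: cF. Qed.

Lemma scontM d (F G : 'rV[R]_d -> R) : scont F -> scont G -> scont (fun x => F x * G x).
Proof. by move=> cF cG u x ux; apply: cvgM; [exact: cF|exact: cG]. Qed.

Lemma scont_comp d (f : R -> R) (F : 'rV[R]_d -> R) :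
  continuous f -> scont F -> scont (fun x => f (F x)).
Proof. by move=> cf cF u x ux; apply: continuous_cvg; [exact: cf|exact: cF]. Qed.

Lemma scont_sum d (I : Type) (r : seq I) (P : pred I) (F : I -> 'rV[R]_d -> R) :
  (forall i, scont (F i)) -> scont (fun x => \sum_(i <- r | P i) F i x).
Proof.
by move=> cF u x ux; apply: cvg_big => [|i _]; [exact: add_continuous|exact: cF].
Qed.

Lemma scont_norm1 d : scont (@norm1 d).
Proof.
by apply: scont_sum => i u x ux; apply: cvg_norm; exact: ux.
Qed.

Lemma scont_slice d (F : 'rV[R]_d.+1 -> R) t : scont F -> scont (fun v => F (cons_row t v)).
Proof. by move=> cF u x ux; apply: cF; apply: cvg_cons_row => //; exact: cvg_cst. Qed.

End SequentialContinuity.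

(** * Iterated integrals of exponentially dominated functions *)

Section Rint.
Variable R : realType.
Local Notation mu := (@lebesgue_measure R).

Lemma integrable_exp_abs : mu.-integrable setT (EFin \o (fun t => expR (- `|t|))).
Proof.
have c1 : continuous (fun t : R => expR (- `|t|)).
  move=> t; apply: continuous_comp; last exact: continuous_expR.
  apply: continuousN; exact: norm_continuous.
apply/integrableP; split.
  by apply/measurable_EFinP; exact: continuous_measurable_fun.
rewrite (@eq_integral _ _ _ mu _ (fun t : R => (expR (- `|t|))%:E)); last first.
  by move=> t _ /=; rewrite ger0_norm ?expR_ge0.
rewrite ge0_symfun_integralT//; last by move=> t /=; rewrite normrN.
rewrite -set_itvcy.
rewrite (@eq_integral _ _ _ mu _ (fun t : R => (expR (- t))%:E)); last first.
  by move=> t; rewrite inE /= in_itv /= andbT => t0; rewrite (ger0_norm t0).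
have d1 (x : R) : is_derive x 1 (fun x => - expR (- x)) (expR (- x)).
  by apply: is_derive_eq; rewrite /GRing.scale /= mulrN1 opprK.
rewrite (@ge0_continuous_FTC2y _ _ (fun x => - expR (- x)) _ 0)//.
- by rewrite -EFinB -EFinM ltry.
- have c2 : continuous (fun x : R => expR (- x)).
    move=> t; apply: continuous_comp; last exact: continuous_expR.
    exact: continuousN.
  exact: (continuous_subspaceT c2).
- by rewrite -oppr0; apply: cvgN; exact: cvgr_expR.
- apply: cvg_at_right_filter.
  have [/derivable1_diffP/differentiable_continuous c3 _] := d1 0.
  exact: c3.
- by move=> x _; rewrite derive1E; exact: derive_val.
Qed.

(** Real-valued twin of [iintE]; the two agree on [gclass], where every partial integral is
    finite. *)
Fixpoint rint d : ('rV[R]_d -> R) -> R :=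
  match d with
  | 0 => fun F => F 0
  | d'.+1 => fun F => \int[mu]_t rint (fun v => F (cons_row t v))
  end.

(** The dominating function has product form: freezing the first coordinate at [t] only changes [C]
    to [C * expR (- |t|)], so inductions on [d] go slice by slice. *)
Definition gdom d (C : R) (F : 'rV[R]_d -> R) := forall x, `|F x| <= C * expR (- norm1 x).

Definition gclass d (F : 'rV[R]_d -> R) := scont F /\ exists C, gdom C F.

Lemma gdom_slice d C (F : 'rV[R]_d.+1 -> R) t : gdom C F ->
  gdom (C * expR (- `|t|)) (fun v => F (cons_row t v)).
Proof.
by move=> CF v; rewrite (le_trans (CF _))// norm1_cons opprD expRD mulrA.
Qed.

Lemma gclass_slice d (F : 'rV[R]_d.+1 -> R) t : gclass F -> gclass (fun v => F (cons_row t v)).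
Proof.
move=> [cF [C CF]]; split; first exact: scont_slice.
by exists (C * expR (- `|t|)); exact: gdom_slice.
Qed.

Let I1 : R := \int[mu]_t expR (- `|t|).

Let I1_ge0 : 0 <= I1.
Proof. by apply: Rintegral_ge0 => t _; exact: expR_ge0. Qed.

Lemma gdom_ge0 d C (F : 'rV[R]_d -> R) : gdom C F -> 0 <= C.
Proof.
move=> /(_ 0) H; have := le_trans (normr_ge0 _) H.
by rewrite pmulr_lge0 ?expR_gt0.
Qed.

Lemma integrable_dom (g : R -> R) (C : R) : continuous g ->
  (forall t, `|g t| <= C * expR (- `|t|)) -> mu.-integrable setT (EFin \o g).
Proof.
move=> cg Cg.
have H := integrableZl measurableT C integrable_exp_abs.
apply: le_integrable H => //.
- by apply/measurable_EFinP; exact: continuous_measurable_fun.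
- by move=> t _ /=; rewrite lee_fin (le_trans (Cg t))// ler_norm.
Qed.

(** The two halves are proved together because the induction needs both: dominated convergence in
    dimension [d] makes the partial integral continuous in the first coordinate, hence measurable,
    and the bound makes it integrable. *)
Lemma rint_dct_bound d :
  (forall (F_ : nat -> 'rV[R]_d -> R) F C, (forall n, scont (F_ n)) -> scont F ->
    (forall n, gdom C (F_ n)) -> (forall x, F_ n x @[n --> \oo] --> F x) ->
    rint (F_ n) @[n --> \oo] --> rint F) /\
  (forall F C, scont F -> gdom C F -> `|@rint d F| <= C * I1 ^+ d).
Proof.
elim: d => [|d [IH1 IH2]].
  split=> [F_ F C _ _ _ H|F C _ H]; first exact: H.
  by rewrite /= expr0 mulr1; have := H 0; rewrite /norm1 big_ord0 oppr0 expR0 mulr1.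
have cslice (F : 'rV[R]_d.+1 -> R) C : scont F -> gdom C F ->
    continuous (fun t => rint (fun v => F (cons_row t v))).
  move=> cF CF t0; apply/continuous_withinNx/cvgr_dnbhsP => u [_ ut].
  apply: (IH1 (fun n v => F (cons_row (u n) v)) (fun v => F (cons_row t0 v)) C).
  - by move=> n; exact: scont_slice.
  - exact: scont_slice.
  - move=> n v; rewrite (le_trans (gdom_slice (u n) CF v))// ler_wpM2r ?expR_ge0//.
    by rewrite ler_piMr ?(gdom_ge0 CF)// -expR0 ler_expR oppr_le0.
  - by move=> x; apply: cF; apply: cvg_cons_row => //; exact: cvg_coord_cst.
have bslice (F : 'rV[R]_d.+1 -> R) C t : scont F -> gdom C F ->
    `|rint (fun v => F (cons_row t v))| <= C * I1 ^+ d * expR (- `|t|).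
  move=> cF CF; rewrite mulrAC; apply: IH2; first exact: scont_slice.
  exact: gdom_slice.
split=> [F_ F C cF_ cF CF_ F_F|F C cF CF].
- have CF : gdom C F.
    move=> x; apply: cvgr_to_le (cvg_norm (F_F x)) _.
    by apply: nearW => n; exact: CF_.
  have [||||| _ _ K] := @dominated_convergence _ _ R mu setT measurableT
    (fun n t => (rint (fun v => F_ n (cons_row t v)))%:E)
    (fun t => (rint (fun v => F (cons_row t v)))%:E)
    (fun t => (C * I1 ^+ d * expR (- `|t|))%:E).
  + move=> n; apply/measurable_EFinP; apply: continuous_measurable_fun.
    exact: cslice (CF_ n).
  + apply/measurable_EFinP; apply: continuous_measurable_fun.
    exact: cslice CF.
  + apply: aeW => t _; apply: cvg_EFin; first exact: nearW.
    apply: (IH1 _ _ (C * expR (- `|t|))).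
    * by move=> n; exact: scont_slice.
    * exact: scont_slice.
    * by move=> n; exact: gdom_slice.
    * by move=> x; exact: F_F.
  + exact: (integrableZl measurableT (C * I1 ^+ d) integrable_exp_abs).
  + by apply: aeW => t n _ /=; rewrite lee_fin; exact: bslice.
  rewrite /=; apply: fine_cvg; rewrite fineK//.
  apply: integrable_fin_num => //.
  apply: (integrable_dom (C := C * I1 ^+ d)); first exact: cslice CF.
  by move=> t; exact: bslice.
- have iF : mu.-integrable setT (EFin \o (fun t => rint (fun v => F (cons_row t v)))).
    apply: (integrable_dom (C := C * I1 ^+ d)); first exact: cslice CF.
    by move=> t; exact: bslice.
  rewrite /= (le_trans (le_normr_Rintegral _ iF))//.
  rewrite exprSr mulrA -RintegralZl//; last exact: integrable_exp_abs.
  apply: le_Rintegral => //; last by move=> t _; exact: bslice.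
  + exact: integrable_norm.
  + exact: (integrableZl measurableT (C * I1 ^+ d) integrable_exp_abs).
Qed.

End Rint.

(** * Linearity, translation invariance and Prekopa-Leindler for iterated integrals *)

Section RintTheory.
Variable R : realType.
Local Notation mu := (@lebesgue_measure R).

Lemma rint_dct d (F_ : nat -> 'rV[R]_d -> R) F C :
  (forall n, scont (F_ n)) -> scont F -> (forall n, gdom C (F_ n)) ->
  (forall x, F_ n x @[n --> \oo] --> F x) ->
  rint (F_ n) @[n --> \oo] --> rint F.
Proof. exact: (rint_dct_bound R d).1. Qed.

Section Slices.
Variables (d : nat) (F : 'rV[R]_d.+1 -> R).
Hypothesis gF : gclass F.

Lemma rslice_bound : exists C, forall t,
  `|rint (fun v => F (cons_row t v))| <= C * expR (- `|t|).
Proof.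
case: gF => cF [C CF].
exists (C * (\int[mu]_t expR (- `|t|)) ^+ d) => t; rewrite mulrAC.
apply: (rint_dct_bound R d).2; first exact: scont_slice.
exact: gdom_slice.
Qed.

Lemma rslice_continuous : continuous (fun t => rint (fun v => F (cons_row t v))).
Proof.
case: gF => cF [C CF] t0; apply/continuous_withinNx/cvgr_dnbhsP => u [_ ut].
apply: (@rint_dct _ (fun n v => F (cons_row (u n) v)) (fun v => F (cons_row t0 v)) C).
- by move=> n; exact: scont_slice.
- exact: scont_slice.
- move=> n v; rewrite (le_trans (gdom_slice (u n) CF v))// ler_wpM2r ?expR_ge0//.
  by rewrite ler_piMr ?(gdom_ge0 CF)// -expR0 ler_expR oppr_le0.
- by move=> x; apply: cF; apply: cvg_cons_row => //; exact: cvg_coord_cst.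
Qed.

Lemma rslice_integrable : mu.-integrable setT
  (EFin \o (fun t => rint (fun v => F (cons_row t v)))).
Proof.
by have [C CF] := rslice_bound; apply: (integrable_dom rslice_continuous CF).
Qed.

End Slices.

Lemma gclassD d (F G : 'rV[R]_d -> R) : gclass F -> gclass G -> gclass (fun x => F x + G x).
Proof.
move=> [cF [C CF]] [cG [D DG]]; split; first exact: scontD.
by exists (C + D) => x; rewrite mulrDl (le_trans (ler_normD _ _))// lerD.
Qed.

Lemma gclassZ d (a : R) (F : 'rV[R]_d -> R) : gclass F -> gclass (fun x => a * F x).
Proof.
move=> [cF [C CF]]; split; first by apply: scontM => //; exact: scont_cst.
by exists (`|a| * C) => x; rewrite normrM -mulrA ler_wpM2l.
Qed.

Lemma gclass_norm d (F : 'rV[R]_d -> R) : gclass F -> gclass (fun x => `|F x|).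
Proof.
move=> [cF [C CF]]; split; first by move=> u x ux; apply: cvg_norm; exact: cF.
by exists C => x; rewrite normr_id.
Qed.

Lemma gclass0 d : gclass (fun _ : 'rV[R]_d => 0).
Proof. by split; [exact: scont_cst|exists 0 => x; rewrite normr0 mul0r]. Qed.

Lemma gclass_shift d (F : 'rV[R]_d -> R) u : gclass F -> gclass (fun x => F (x + u)).
Proof.
move=> [cF [C CF]]; split.
  move=> v x vx; apply: cF => i; rewrite mxE; under eq_cvg do rewrite mxE.
  by apply: cvgD; [exact: vx|exact: cvg_cst].
exists (C * expR (norm1 u)) => x; rewrite (le_trans (CF _))// -mulrA -expRD.
rewrite ler_wpM2l ?(gdom_ge0 CF)// ler_expR.
have := norm1D (x + u) (- u); rewrite addrK -scaleN1r norm1Z normrN1 mul1r.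
lra.
Qed.

Lemma rintD d (F G : 'rV[R]_d -> R) : gclass F -> gclass G ->
  rint (fun x => F x + G x) = rint F + rint G.
Proof.
elim: d F G => [//|d IH] F G gF gG /=.
rewrite -RintegralD//; [|exact: rslice_integrable..].
by apply: eq_Rintegral => t _; apply: IH; exact: gclass_slice.
Qed.

Lemma rintZ d a (F : 'rV[R]_d -> R) : gclass F -> rint (fun x => a * F x) = a * rint F.
Proof.
elim: d F => [//|d IH] F gF /=.
rewrite -RintegralZl//; last exact: rslice_integrable.
by apply: eq_Rintegral => t _; apply: IH; exact: gclass_slice.
Qed.

Lemma le_rint d (F G : 'rV[R]_d -> R) : gclass F -> gclass G ->
  (forall x, F x <= G x) -> rint F <= rint G.
Proof.
elim: d F G => [|d IH] F G gF gG FG /=; first exact: FG.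
apply: le_Rintegral => //; [exact: rslice_integrable..|].
by move=> t _; apply: IH => //; exact: gclass_slice.
Qed.

Lemma rint0 d : rint (fun _ : 'rV[R]_d => 0) = 0.
Proof.
by have := rintZ 0 (gclass0 d); rewrite !mul0r.
Qed.

Lemma rint_ge0 d (F : 'rV[R]_d -> R) : gclass F -> (forall x, 0 <= F x) -> 0 <= rint F.
Proof. by move=> gF F0; rewrite -(rint0 d); apply: le_rint => //; exact: gclass0. Qed.

Lemma rint_gt0 d (F : 'rV[R]_d -> R) : gclass F -> (forall x, 0 < F x) -> 0 < rint F.
Proof.
elim: d F => [|d IH] F gF F0 /=; first exact: F0.
apply: Rintegral_gt0; [exact: rslice_continuous|exact: rslice_integrable|].
by move=> t; apply: IH => //; exact: gclass_slice.
Qed.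

Lemma cons_rowD d s t (v w : 'rV[R]_d) :
  cons_row s v + cons_row t w = cons_row (s + t) (v + w).
Proof.
apply/rowP => i; rewrite mxE; case: (@splitP 1 d i) => j ij.
- by have -> : i = lshift d j by [apply/val_inj]; rewrite !cons_row0.
- by have -> : i = rshift 1 j by [apply/val_inj]; rewrite !cons_rowS mxE.
Qed.

Lemma cons_rowZ d a t (v : 'rV[R]_d) : a *: cons_row t v = cons_row (a * t) (a *: v).
Proof.
apply/rowP => i; rewrite mxE; case: (@splitP 1 d i) => j ij.
- by have -> : i = lshift d j by [apply/val_inj]; rewrite !cons_row0.
- by have -> : i = rshift 1 j by [apply/val_inj]; rewrite !cons_rowS mxE.
Qed.

Lemma Rintegral_shift (g : R -> R) (s : R) : continuous g -> (forall t, 0 <= g t) ->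
  \int[mu]_t g (t + s) = \int[mu]_t g t.
Proof.
move=> cg g0; rewrite /Rintegral; congr fine.
have d1 (x : R) : is_derive x 1 (fun x : R => x + s) 1.
  by apply: is_derive_eq; rewrite addr0.
have dE : derive1 (fun x : R => x + s) = fun=> 1.
  by apply/funext => x; rewrite derive1E; have [_ ->] := d1 x.
rewrite [RHS](@increasing_ge0_integration_by_substitutionT _ (fun x => x + s))//.
- by apply: eq_integral => x _; rewrite /= dE mulr1.
- by move=> x y; rewrite ltrD2r.
- by rewrite dE; exact: cst_continuous.
- by rewrite dE; exact: is_cvg_cst.
- by rewrite dE; exact: is_cvg_cst.
- exact: cvg_addrr_Ny.
- exact: cvg_addrr.
Qed.

Lemma rint_shift d (F : 'rV[R]_d -> R) u : gclass F -> (forall x, 0 <= F x) ->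
  rint (fun x => F (x + u)) = rint F.
Proof.
elim: d F u => [|d IH] F u gF F0 /=; first by congr F; apply/matrixP => i [].
have [s [w ->]] := cons_rowP u.
rewrite -(Rintegral_shift s (rslice_continuous gF)); last first.
  by move=> t; apply: rint_ge0 => //; exact: gclass_slice.
apply: eq_Rintegral => t _ /=.
rewrite -(IH _ w (gclass_slice (t + s) gF))//.
by congr rint; apply/funext => v; rewrite cons_rowD.
Qed.

(** Tensorisation: with first coordinates [s], [t] and their midpoint frozen, the induction
    hypothesis for the slices is exactly the one-dimensional hypothesis for the partial
    integrals. *)
Lemma prekopa_leindler d (a b c : 'rV[R]_d -> R) :
  gclass a -> gclass b -> gclass c ->
  (forall x, 0 < a x) -> (forall x, 0 < b x) -> (forall x, 0 < c x) ->
  (forall x y, a x * b y <= c (2^-1 *: (x + y)) ^+ 2) ->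
  rint a * rint b <= rint c ^+ 2.
Proof.
elim: d a b c => [|d IH] a b c ga gb gc a0 b0 c0 abc /=.
  by have := abc 0 0; rewrite addr0 scaler0.
have pos (f : 'rV[R]_d.+1 -> R) : gclass f -> (forall x, 0 < f x) ->
    forall t, 0 < rint (fun v => f (cons_row t v)).
  by move=> gf f0 t; apply: rint_gt0 => //; exact: gclass_slice.
apply: prekopa_leindler1; try exact: rslice_continuous; try exact: rslice_integrable;
  try exact: pos.
move=> s t; apply: IH => //; try exact: gclass_slice.
move=> v w; apply: le_trans (abc _ _) _.
by rewrite cons_rowD cons_rowZ.
Qed.

Lemma iintE_rint d (F : 'rV[R]_d -> R) : gclass F -> iintE F = (rint F)%:E.
Proof.
elim: d F => [//|d IH] F gF /=.
rewrite /Rintegral fineK; last exact: integrable_fin_num (rslice_integrable gF).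
by apply: eq_integral => t _; rewrite IH//; exact: gclass_slice.
Qed.

(** Writing [max x 0 = (x + |x|) / 2] keeps the positive and negative parts inside [gclass], so no
    infinite value reaches the subtraction in [iint]. *)
Lemma iint_rint d (F : 'rV[R]_d -> R) : gclass F -> iint F = rint F.
Proof.
move=> gF.
have maxE (x : R) : Num.max x 0 = 2^-1 * (x + `|x|).
  by case: (ltrgt0P x) => [x0|x0|->]; lra.
have gmax (G : 'rV[R]_d -> R) : gclass G -> gclass (fun x => Num.max (G x) 0).
  move=> gG; under eq_fun do rewrite maxE.
  by apply: gclassZ; apply: gclassD => //; exact: gclass_norm.
have gN : gclass (fun x => - F x).
  by under eq_fun do rewrite -mulN1r; exact: gclassZ.
have gF1 := gmax _ gF; have gF2 := gmax _ gN.
rewrite /iint !iintE_rint// -EFinB /= -mulN1r -rintZ// -rintD//; last exact: gclassZ.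
congr rint; apply/funext => x; rewrite !maxE normrN; lra.
Qed.

End RintTheory.

(** * Euclidean geometry of row vectors *)

Section Euclid.
Variables (R : realType) (d : nat).
Implicit Types x y z : 'rV[R]_d.

Definition dot x y : R := \sum_(i < d) x 0 i * y 0 i.

Lemma dotC x y : dot x y = dot y x.
Proof. by apply: eq_bigr => i _; rewrite mulrC. Qed.

Lemma dotDl x y z : dot (x + y) z = dot x z + dot y z.
Proof. by rewrite /dot -big_split; apply: eq_bigr => i _; rewrite mxE mulrDl. Qed.

Lemma dotDr x y z : dot z (x + y) = dot z x + dot z y.
Proof. by rewrite !(dotC z) dotDl. Qed.

Lemma dotZl a x y : dot (a *: x) y = a * dot x y.
Proof. by rewrite /dot mulr_sumr; apply: eq_bigr => i _; rewrite mxE mulrA. Qed.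

Lemma dotZr a x y : dot x (a *: y) = a * dot x y.
Proof. by rewrite !(dotC x) dotZl. Qed.

Lemma dotNl x y : dot (- x) y = - dot x y.
Proof. by rewrite -scaleN1r dotZl mulN1r. Qed.

Lemma dotNr x y : dot x (- y) = - dot x y.
Proof. by rewrite !(dotC x) dotNl. Qed.

Lemma dot0l x : dot 0 x = 0.
Proof. by rewrite -(scale0r 0) dotZl mul0r. Qed.

Definition dotE := (dotDl, dotDr, dotNl, dotNr, dotZl, dotZr).

Lemma enorm_ge0 x : 0 <= enorm x.
Proof. exact: sqrtr_ge0. Qed.

Lemma sqr_enorm x : enorm x ^+ 2 = dot x x.
Proof.
rewrite /enorm sqr_sqrtr; last by apply: sumr_ge0 => i _; rewrite sqr_ge0.
by apply: eq_bigr => i _; rewrite expr2.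
Qed.

Lemma dot_ge0 x : 0 <= dot x x.
Proof. by rewrite -sqr_enorm sqr_ge0. Qed.

Lemma enorm_le x (c : R) : 0 <= c -> dot x x <= c ^+ 2 -> enorm x <= c.
Proof. by move=> c0; rewrite -sqr_enorm ler_pXn2r// nnegrE ?enorm_ge0. Qed.

Lemma enorm_coord x i : `|x 0 i| <= enorm x.
Proof.
rewrite -(@ler_pXn2r _ 2)// ?nnegrE ?enorm_ge0// sqr_enorm /dot (bigD1 i)//=.
rewrite real_normK ?num_real// expr2 lerDl sumr_ge0// => j _.
by rewrite -expr2 sqr_ge0.
Qed.

Lemma enorm0_eq x : enorm x = 0 -> x = 0.
Proof.
move=> x0; apply/rowP => i; rewrite mxE; apply/eqP.
by rewrite -normr_le0 -x0 enorm_coord.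
Qed.

Lemma enormZ a x : enorm (a *: x) = `|a| * enorm x.
Proof.
apply/eqP; rewrite -(@eqrXn2 _ 2)// ?mulr_ge0 ?enorm_ge0//.
by rewrite exprMn !sqr_enorm !dotE real_normK ?num_real// mulrA -expr2.
Qed.

Lemma enormN x : enorm (- x) = enorm x.
Proof. by rewrite -scaleN1r enormZ normrN1 mul1r. Qed.

Lemma enormB x y : enorm (x - y) = enorm (y - x).
Proof. by rewrite -enormN opprB. Qed.

Lemma dot_le x y : dot x y <= enorm x * enorm y.
Proof.
have [x0|x0] := eqVneq (enorm x) 0.
  by rewrite (enorm0_eq x0) dot0l mulr_ge0 ?enorm_ge0.
have [y0|y0] := eqVneq (enorm y) 0.
  by rewrite (enorm0_eq y0) dotC dot0l mulr_ge0 ?enorm_ge0.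
have := dot_ge0 (enorm y *: x - enorm x *: y).
rewrite !dotE (dotC y x) -!sqr_enorm.
have xy : 0 < enorm x * enorm y by rewrite mulr_gt0// lt0r enorm_ge0 ?x0 ?y0.
move=> H; rewrite -(ler_pM2l xy); lra.
Qed.

Lemma normr_dot_le x y : `|dot x y| <= enorm x * enorm y.
Proof.
rewrite ler_norml dot_le andbT lerNl -dotNl.
by rewrite (le_trans (dot_le _ _))// enormN.
Qed.

Lemma enormD x y : enorm (x + y) <= enorm x + enorm y.
Proof.
apply: enorm_le; first by rewrite addr_ge0 ?enorm_ge0.
rewrite !dotE (dotC y x) sqrrD !sqr_enorm -mulr_natl.
have := dot_le x y; lra.
Qed.

Lemma enorm_le_norm1 x : enorm x <= norm1 x.
Proof.
apply: enorm_le; first exact: norm1_ge0.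
rewrite expr2 {1}/norm1 mulr_suml; apply: ler_sum => i _.
rewrite -expr2 -real_normK ?num_real// expr2 ler_wpM2l//.
exact: norm1_coord.
Qed.

Lemma norm1_le_enorm x : norm1 x <= d%:R * enorm x.
Proof.
rewrite -[d in d%:R]card_ord mulr_natl -sumr_const.
by apply: ler_sum => i _; exact: enorm_coord.
Qed.

Lemma scont_dot (f g : 'rV[R]_d -> 'rV[R]_d) :
  (forall i, scont (fun x => f x 0 i)) -> (forall i, scont (fun x => g x 0 i)) ->
  scont (fun x => dot (f x) (g x)).
Proof. by move=> cf cg; apply: scont_sum => i; exact: scontM. Qed.

Lemma cvg_coord_enorm (u : nat -> 'rV[R]_d) x : cvg_coord u x ->
  enorm (u n - x) @[n --> \oo] --> 0.
Proof.
move=> ux.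
have H : norm1 (u n - x) @[n --> \oo] --> norm1 (0 : 'rV[R]_d).
  apply: (@scont_norm1 R d (fun n => u n - x)) => i.
  rewrite mxE -(subrr (x 0 i)); under eq_cvg do rewrite !mxE.
  by apply: cvgB; [exact: ux|exact: cvg_cst].
have n0 : norm1 (0 : 'rV[R]_d) = 0.
  by rewrite /norm1 big1// => i _; rewrite mxE normr0.
rewrite n0 in H.
apply: (@squeeze_cvgr _ _ _ _ (fun=> 0) (fun n => norm1 (u n - x))) H; last exact: cvg_cst.
by apply: nearW => n; rewrite enorm_ge0 enorm_le_norm1.
Qed.

Lemma lipschitz_scont (f : 'rV[R]_d -> R) K :
  (forall x y, `|f x - f y| <= K * enorm (x - y)) -> scont f.
Proof.
move=> fK u x /cvg_coord_enorm ux.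
have H : K * enorm (u n - x) @[n --> \oo] --> 0.
  by rewrite -(mulr0 K); apply: cvgM => //; exact: cvg_cst.
apply/subr_cvg0/cvgr0Pnorm_le => e e0.
move/cvgr0Pnorm_le : H => /(_ e e0); apply: filterS => n; apply: le_trans.
by rewrite (le_trans (fK _ _))// ler_norm.
Qed.

End Euclid.

Section ExpTaylor.
Variable R : realType.

(** Odd degree makes the Taylor polynomial a lower bound on the whole line: [g3] has derivative
    [g2], which is nondecreasing and vanishes at 0, so [g3] is smallest at 0. *)
Lemma expR_ge_taylor3 (u : R) : 1 + u + 2^-1 * u ^+ 2 + 6^-1 * u ^+ 3 <= expR u.
Proof.
pose g2 (x : R) := expR x - 1 - x - 2^-1 * x ^+ 2.
pose g3 (x : R) := expR x - 1 - x - 2^-1 * x ^+ 2 - 6^-1 * x ^+ 3.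
have d2 (x : R) : is_derive x 1 g2 (expR x - 1 - x).
  by apply: is_derive_eq; rewrite /GRing.scale /=; field.
have d3 (x : R) : is_derive x 1 g3 (g2 x).
  by apply: is_derive_eq; rewrite /GRing.scale /= /g2; field.
have g2_mono x y : x <= y -> g2 x <= g2 y.
  apply: derive_le d2 _ => t; rewrite -addrA -opprD subr_ge0; exact: expR_ge1Dx.
have g20 : g2 0 = 0 by rewrite /g2 expR0; lra.
have g30 : g3 0 = 0 by rewrite /g3 expR0; lra.
suff : 0 <= g3 u by rewrite /g3; lra.
have [u0|u0] := leP 0 u.
- have [c] := MVT_segment u0 (fun t _ => d3 t) (is_derive_within d3).
  rewrite in_itv /= => /andP[c0 _]; rewrite g30 !subr0 => ->.
  by rewrite mulr_ge0// -g20 g2_mono.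
- have [c] := MVT_segment (ltW u0) (fun t _ => d3 t) (is_derive_within d3).
  rewrite in_itv /= => /andP[_ c0]; rewrite g30 sub0r => /eqP; rewrite eqr_oppLR => /eqP ->.
  by rewrite sub0r mulrN opprK mulr_le0 ?(ltW u0)// -g20 g2_mono.
Qed.

End ExpTaylor.

(** * Growth classes, and expectations under a rapidly decaying weight *)

Section Growth.
Variables (R : realType) (d : nat).
Implicit Types f g W : 'rV[R]_d -> R.

(** Exponential growth is what a tangent to [ln p] yields for [p], and a Gaussian factor beats every
    exponential. A [rapid] weight times an [egrowth] function is in [gclass], so all expectations
    below exist. *)
Definition egrowth f := scont f /\
  exists C b, 0 <= b /\ forall x, `|f x| <= C * expR (b * norm1 x).

Definition rapid W := scont W /\
  forall b, exists C, forall x, `|W x| <= C * expR (- (b * norm1 x)).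

Lemma egrowth_cst (a : R) : egrowth (fun=> a).
Proof.
split; first exact: scont_cst.
by exists `|a|, 0; split=> // x; rewrite mul0r expR0 mulr1.
Qed.

Lemma norm1_le_expR (x : 'rV[R]_d) : norm1 x <= expR (norm1 x).
Proof. by rewrite (le_trans _ (expR_ge1Dx _))// lerDr. Qed.

Lemma egrowth_norm1 : egrowth (@norm1 R d).
Proof.
split; first exact: scont_norm1.
exists 1, 1; split=> // x.
by rewrite !mul1r ger0_norm ?norm1_ge0// norm1_le_expR.
Qed.

Lemma egrowth_le f g : scont f -> egrowth g -> (forall x, `|f x| <= g x) -> egrowth f.
Proof.
move=> cf [cg [C [b [b0 Cg]]]] fg; split=> //; exists C, b; split=> // x.
by rewrite (le_trans (fg x))// (le_trans (ler_norm _)).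
Qed.

Lemma egrowth_coord i : egrowth (fun x => x 0 i).
Proof.
apply: (egrowth_le _ egrowth_norm1); first exact: scont_coord.
by move=> x; exact: norm1_coord.
Qed.

Lemma egrowthD f g : egrowth f -> egrowth g -> egrowth (fun x => f x + g x).
Proof.
move=> [cf [C [b [b0 Cf]]]] [cg [D [c [c0 Dg]]]]; split; first exact: scontD.
have C0 : 0 <= C by have := le_trans (normr_ge0 _) (Cf 0); rewrite pmulr_lge0 ?expR_gt0.
have D0 : 0 <= D by have := le_trans (normr_ge0 _) (Dg 0); rewrite pmulr_lge0 ?expR_gt0.
exists (C + D), (b + c); split=> [|x]; first exact: addr_ge0.
rewrite (le_trans (ler_normD _ _))// mulrDl lerD//.
- by rewrite (le_trans (Cf x))// ler_wpM2l// ler_expR ler_wpM2r ?norm1_ge0// lerDl.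
- by rewrite (le_trans (Dg x))// ler_wpM2l// ler_expR ler_wpM2r ?norm1_ge0// lerDr.
Qed.

Lemma egrowthM f g : egrowth f -> egrowth g -> egrowth (fun x => f x * g x).
Proof.
move=> [cf [C [b [b0 Cf]]]] [cg [D [c [c0 Dg]]]]; split; first exact: scontM.
exists (C * D), (b + c); split=> [|x]; first exact: addr_ge0.
by rewrite normrM mulrDl expRD mulrACA ler_pM.
Qed.

Lemma egrowthZ a f : egrowth f -> egrowth (fun x => a * f x).
Proof. by apply: egrowthM; exact: egrowth_cst. Qed.

Lemma egrowthN f : egrowth f -> egrowth (fun x => - f x).
Proof. by move=> gf; under eq_fun do rewrite -mulN1r; exact: egrowthZ. Qed.

Lemma egrowthB f g : egrowth f -> egrowth g -> egrowth (fun x => f x - g x).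
Proof. by move=> gf gg; apply: egrowthD => //; exact: egrowthN. Qed.

Lemma egrowthX f n : egrowth f -> egrowth (fun x => f x ^+ n).
Proof.
move=> gf; elim: n => [|n IH]; first exact: egrowth_cst.
by under eq_fun do rewrite exprS; exact: egrowthM.
Qed.

Lemma egrowth_norm f : egrowth f -> egrowth (fun x => `|f x|).
Proof.
move=> [cf [C [b [b0 Cf]]]]; split.
  by move=> u x ux; apply: cvg_norm; exact: cf.
by exists C, b; split=> // x; rewrite normr_id.
Qed.

Lemma egrowth_sum (I : Type) (r : seq I) (F : I -> 'rV[R]_d -> R) :
  (forall i, egrowth (F i)) -> egrowth (fun x => \sum_(i <- r) F i x).
Proof.
move=> gF; elim: r => [|i r IH].
  by under eq_fun do rewrite big_nil; exact: egrowth_cst.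
by under eq_fun do rewrite big_cons; exact: egrowthD.
Qed.

Lemma egrowth_expR f A B : scont f -> 0 <= B -> (forall x, f x <= A + B * norm1 x) ->
  egrowth (fun x => expR (f x)).
Proof.
move=> cf B0 fAB; split; first by apply: scont_comp => //; exact: continuous_expR.
exists (expR A), B; split=> // x.
by rewrite ger0_norm ?expR_ge0// -expRD ler_expR.
Qed.

Lemma lipschitz_bound f K : (forall x y, `|f x - f y| <= K * enorm (x - y)) -> 0 <= K ->
  forall x, `|f x| <= `|f 0| + K * norm1 x.
Proof.
move=> fK K0 x; rewrite -[X in `|X|](subrK (f 0)) addrC (le_trans (ler_normD _ _))//.
rewrite lerD2l (le_trans (fK _ _))// subr0 ler_wpM2l//; exact: enorm_le_norm1.
Qed.

Lemma lipschitz_egrowth f K : (forall x y, `|f x - f y| <= K * enorm (x - y)) -> 0 <= K ->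
  egrowth f.
Proof.
move=> fK K0.
apply: (@egrowth_le _ (fun x => `|f 0| + K * norm1 x)); last exact: lipschitz_bound.
- exact: lipschitz_scont fK.
- apply: egrowthD; first exact: egrowth_cst.
  by apply: egrowthZ; exact: egrowth_norm1.
Qed.

Lemma scont_affine f m t : scont f -> scont (fun x => f (m + t *: (x - m))).
Proof.
move=> cf u x ux; apply: cf => i; rewrite !mxE; under eq_cvg do rewrite !mxE.
apply: cvgD; first exact: cvg_cst.
apply: cvgM; first exact: cvg_cst.
by apply: cvgB; [exact: ux|exact: cvg_cst].
Qed.

Lemma egrowth_affine f m t : egrowth f -> egrowth (fun x => f (m + t *: (x - m))).
Proof.
move=> [cf [C [b [b0 Cf]]]]; split; first exact: scont_affine.
have C0 : 0 <= C by have := le_trans (normr_ge0 _) (Cf 0); rewrite pmulr_lge0 ?expR_gt0.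
exists (C * expR (b * (norm1 m + `|t| * norm1 m))), (b * `|t|); split=> [|x].
  by rewrite mulr_ge0.
rewrite (le_trans (Cf _))// -mulrA ler_wpM2l// -expRD ler_expR -mulrA -mulrDr ler_wpM2l//.
rewrite (le_trans (norm1D _ _))// norm1Z -addrA lerD2l -mulrDr ler_wpM2l//.
have := norm1D x (- m); rewrite -[norm1 (- m)]mul1r -normrN1 -norm1Z scaleN1r opprK.
by rewrite [norm1 x + _]addrC.
Qed.

Lemma rapid_gclass W f : rapid W -> egrowth f -> gclass (fun x => W x * f x).
Proof.
move=> [cW WC] [cf [C [b [b0 Cf]]]]; split; first exact: scontM.
have [D DW] := WC (b + 1); exists (D * C) => x.
rewrite normrM (_ : - norm1 x = - ((b + 1) * norm1 x) + b * norm1 x); last by ring.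
by rewrite expRD mulrACA ler_pM.
Qed.

End Growth.

Section Expectation.
Variables (R : realType) (d : nat) (W : 'rV[R]_d -> R).
Hypothesis rW : rapid W.
Hypothesis W_gt0 : forall x, 0 < W x.
Implicit Types f g : 'rV[R]_d -> R.

Definition expect (V : 'rV[R]_d -> R) f := rint (fun x => V x * f x) / rint V.

Lemma rapid_gclass1 : gclass W.
Proof.
have := rapid_gclass rW (egrowth_cst d 1).
by under eq_fun do rewrite mulr1.
Qed.

Lemma rint_rapid_gt0 : 0 < rint W.
Proof. by apply: rint_gt0 => //; exact: rapid_gclass1. Qed.

Local Notation E := (expect W).

Lemma expectD f g : egrowth f -> egrowth g -> E (fun x => f x + g x) = E f + E g.
Proof.
move=> gf gg; rewrite /expect -mulrDl -rintD; [|exact: rapid_gclass..].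
by congr (rint _ / _); apply/funext => x; rewrite mulrDr.
Qed.

Lemma expectZ a f : egrowth f -> E (fun x => a * f x) = a * E f.
Proof.
move=> gf; rewrite /expect mulrA -rintZ; last exact: rapid_gclass.
by congr (rint _ / _); apply/funext => x; rewrite mulrCA.
Qed.

Lemma expect_cst a : E (fun=> a) = a.
Proof.
rewrite -[RHS]mulr1 -[in LHS](mulr1 a) expectZ; last exact: egrowth_cst.
congr (_ * _); rewrite /expect; under eq_fun do rewrite mulr1.
by rewrite divff// gt_eqF// rint_rapid_gt0.
Qed.

Lemma expectN f : egrowth f -> E (fun x => - f x) = - E f.
Proof.
by move=> gf; rewrite -mulN1r -expectZ//; congr expect; apply/funext => x; rewrite mulN1r.
Qed.

Lemma expectB f g : egrowth f -> egrowth g -> E (fun x => f x - g x) = E f - E g.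
Proof. by move=> gf gg; rewrite expectD ?expectN//; exact: egrowthN. Qed.

Lemma expect_sum (I : Type) (r : seq I) (F : I -> 'rV[R]_d -> R) :
  (forall i, egrowth (F i)) -> E (fun x => \sum_(i <- r) F i x) = \sum_(i <- r) E (F i).
Proof.
move=> gF; elim: r => [|i r IH].
  by under eq_fun do rewrite big_nil; rewrite big_nil expect_cst.
under eq_fun do rewrite big_cons.
by rewrite big_cons expectD ?IH//; exact: egrowth_sum.
Qed.

Lemma le_expect f g : egrowth f -> egrowth g -> (forall x, f x <= g x) -> E f <= E g.
Proof.
move=> gf gg fg; rewrite ler_pM2r ?invr_gt0 ?rint_rapid_gt0//.
apply: le_rint; [exact: rapid_gclass..|].
by move=> x; rewrite ler_pM2l.
Qed.

Lemma expect_ge0 f : egrowth f -> (forall x, 0 <= f x) -> 0 <= E f.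
Proof. by move=> gf f0; rewrite -(expect_cst 0) le_expect//; exact: egrowth_cst. Qed.

Lemma expect_dct (f_ : nat -> 'rV[R]_d -> R) f C b :
  (forall n, scont (f_ n)) -> scont f ->
  (forall n x, `|f_ n x| <= C * expR (b * norm1 x)) ->
  (forall x, f_ n x @[n --> \oo] --> f x) -> E (f_ n) @[n --> \oo] --> E f.
Proof.
move=> cf_ cf Cf_ f_f; apply: cvgM; last exact: cvg_cst.
case: rW => cW WC; have [D DW] := WC (b + 1).
apply: (@rint_dct _ _ _ _ (D * C)).
- by move=> n; exact: scontM.
- exact: scontM.
- move=> n x.
  rewrite normrM (_ : - norm1 x = - ((b + 1) * norm1 x) + b * norm1 x); last by ring.
  by rewrite expRD mulrACA ler_pM.
- by move=> x; apply: cvgM; [exact: cvg_cst|exact: f_f].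
Qed.

End Expectation.

(** * A Poincare inequality for strongly log-concave weights *)

Section Poincare.
Variables (R : realType) (d : nat) (W : 'rV[R]_d -> R) (s : R).
Hypothesis rW : rapid W.
Hypothesis W_gt0 : forall x, 0 < W x.
Hypothesis s_gt0 : 0 < s.
Hypothesis W_mid : forall x y,
  W x * W y * expR (enorm (x - y) ^+ 2 / (4 * s ^+ 2)) <= W (2^-1 *: (x + y)) ^+ 2.
Local Notation E := (expect W).

(** Third-order Taylor bound at [e * t - e ^ 2 * r]. All that exceeds order [e ^ 2] goes into a
    remainder depending on [t] and [B] only, whose expectation is thus independent of [e]. *)
Lemma expR_quadratic_lower (e t r B : R) : 0 < e <= 1 -> 0 <= r <= B ->
  1 + e * t + e ^+ 2 * (2^-1 * t ^+ 2 - r - e * (`|t| * B + 6^-1 * (`|t| + B) ^+ 3))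
  <= expR (e * t - e ^+ 2 * r).
Proof.
move=> /andP[e0 e1] /andP[r0 rB]; set u := e * t - e ^+ 2 * r.
apply: le_trans (expR_ge_taylor3 u).
have tle : - `|t| <= t <= `|t| by rewrite -ler_norml.
have B0 : 0 <= B := le_trans r0 rB.
have t0 : 0 <= `|t| by [].
have u_le : `|u| <= e * (`|t| + B).
  rewrite (le_trans (ler_normB _ _))// !normrM (ger0_norm (ltW e0)) (ger0_norm r0).
  rewrite mulrDr lerD2l -mulrA ler_pM2l//.
  by rewrite (le_trans _ rB)// ler_piMl.
have u3 : - (e ^+ 3 * (`|t| + B) ^+ 3) <= u ^+ 3.
  rewrite -exprMn lerNl (le_trans (ler_norm _))// normrN normrX.
  by rewrite lerXn2r ?nnegrE ?mulr_ge0 ?addr_ge0 ?(ltW e0).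
have u2 : 2^-1 * e ^+ 2 * t ^+ 2 - e ^+ 3 * (`|t| * B) <= 2^-1 * u ^+ 2.
  have tr : t * r <= `|t| * B.
    by rewrite (le_trans (ler_norm _))// normrM (ger0_norm r0) ler_wpM2l.
  have -> : 2^-1 * u ^+ 2 = 2^-1 * e ^+ 2 * t ^+ 2 - e ^+ 3 * (t * r)
      + 2^-1 * (e ^+ 2 * r) ^+ 2 by rewrite /u; field.
  have H : e ^+ 3 * (t * r) <= e ^+ 3 * (`|t| * B) by rewrite ler_wpM2l// exprn_ge0 ?(ltW e0).
  by have := sqr_ge0 (e ^+ 2 * r); lra.
have -> : 1 + e * t + e ^+ 2 * (2^-1 * t ^+ 2 - r - e * (`|t| * B + 6^-1 * (`|t| + B) ^+ 3))
  = 1 + u + (2^-1 * e ^+ 2 * t ^+ 2 - e ^+ 3 * (`|t| * B)) + 6^-1 * - (e ^+ 3 * (`|t| + B) ^+ 3).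
  by rewrite /u; field.
by rewrite lerD// ?lerD2l// ler_wpM2l// invr_ge0.
Qed.

Section OneFunction.
Variables (phi : 'rV[R]_d -> R) (K : R).
Hypothesis K_ge0 : 0 <= K.
Hypothesis phi_lip : forall x y, `|phi x - phi y| <= K * enorm (x - y).

(** With [x = y + e v], the gain in [W_mid] is [e ^ 2 |v| ^ 2 / (4 s ^ 2)], so [supslope e] is the
    least [rho] for which the perturbed weights satisfy the Prekopa-Leindler hypothesis. It is a
    rescaled Hopf-Lax supremum, with [s ^ 2 |grad phi| ^ 2] as its formal limit when [e] tends to
    0. *)
Definition slope (e : R) (y v : 'rV[R]_d) :=
  (phi y - phi (y + e *: v)) / e - enorm v ^+ 2 / (4 * s ^+ 2).

Definition supslope e y := sup (range (slope e y)).

Let B := K ^+ 2 * s ^+ 2.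

Lemma quad_le (k r : R) : k * r - r ^+ 2 / (4 * s ^+ 2) <= k ^+ 2 * s ^+ 2.
Proof.
have -> : k * r - r ^+ 2 / (4 * s ^+ 2) = k ^+ 2 * s ^+ 2 - (k * s - r / (2 * s)) ^+ 2.
  by field; rewrite gt_eqF.
by rewrite gerBl sqr_ge0.
Qed.

Lemma slope_le (e : R) y v : 0 < e -> slope e y v <= K * enorm v - enorm v ^+ 2 / (4 * s ^+ 2).
Proof.
move=> e0; rewrite lerD2r ler_pdivrMr// (le_trans (ler_norm _))//.
rewrite (le_trans (phi_lip _ _))// opprD addNKr enormN enormZ gtr0_norm//.
by rewrite -mulrA [e * _]mulrC.
Qed.

Lemma slope_ubound (e : R) y : 0 < e -> ubound (range (slope e y)) B.
Proof.
move=> e0 _ [v _ <-]; rewrite (le_trans (slope_le _ _ e0))//; exact: quad_le.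
Qed.

Lemma supslope_ge (e : R) y v : 0 < e -> slope e y v <= supslope e y.
Proof.
by move=> e0; apply: ub_le_sup; [exists B; exact: slope_ubound|exists v].
Qed.

Lemma supslope_bounds (e : R) y : 0 < e -> 0 <= supslope e y <= B.
Proof.
move=> e0; apply/andP; split.
  apply: le_trans (supslope_ge y 0 e0).
  by rewrite /slope scaler0 addr0 subrr mul0r sqr_enorm dot0l mul0r subr0.
by apply: ge_sup; [exists (slope e y 0), 0|exact: slope_ubound].
Qed.

(** The constant blows up as [e] tends to 0; it only serves to make [supslope e] continuous and of
    controlled growth at fixed [e]. *)
Lemma supslope_lip (e : R) x y : 0 < e ->
  `|supslope e x - supslope e y| <= 2 * K / e * enorm (x - y).
Proof.
move=> e0.
have H u w : supslope e u <= supslope e w + 2 * K / e * enorm (u - w).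
  apply: ge_sup; first by exists (slope e u 0), 0.
  move=> _ [v _ <-]; apply: (@le_trans _ _ (slope e w v + 2 * K / e * enorm (u - w))).
    rewrite /slope -[leRHS]addrAC lerD2r -subr_ge0.
    have -> : (phi w - phi (w + e *: v)) / e + 2 * K / e * enorm (u - w) -
      (phi u - phi (u + e *: v)) / e = (2 * K * enorm (u - w) - (phi u - phi w)
        - (phi (w + e *: v) - phi (u + e *: v))) / e by ring.
    rewrite divr_ge0 ?(ltW e0)//.
    have := le_trans (ler_norm _) (phi_lip u w).
    have := le_trans (ler_norm _) (phi_lip (w + e *: v) (u + e *: v)).
    by rewrite opprD addrACA subrr addr0 [enorm (w - u)]enormB; lra.
  by rewrite lerD2r supslope_ge.
rewrite ler_norml; apply/andP; split.
- by have := H y x; rewrite enormB; lra.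
- by have := H x y; lra.
Qed.

Lemma egrowth_supslope (e : R) : 0 < e -> egrowth (supslope e).
Proof.
move=> e0; apply: (@lipschitz_egrowth _ _ _ (2 * K / e)); first by move=> x y; exact: supslope_lip.
by rewrite divr_ge0 ?mulr_ge0 ?(ltW e0).
Qed.

Lemma egrowth_phi : egrowth phi.
Proof. exact: lipschitz_egrowth phi_lip K_ge0. Qed.

Let psi x := phi x - E phi.

Let psi_egrowth : egrowth psi.
Proof. by apply: egrowthB; [exact: egrowth_phi|exact: egrowth_cst]. Qed.

Let psi_lip x y : `|psi x - psi y| <= K * enorm (x - y).
Proof. by rewrite /psi opprB addrA subrK; exact: phi_lip. Qed.

Definition poincare_error := E (fun x => `|psi x| * B + 6^-1 * (`|psi x| + B) ^+ 3).

(* Prekopa-Leindler for the three weights [W e^(-e psi)], [W e^(e psi - e^2 rho)] and [W],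
   where [rho = supslope e] is chosen so that its hypothesis is the midpoint inequality of [W]. *)
Lemma var_le_supslope (e : R) : 0 < e <= 1 ->
  2^-1 * E (fun x => psi x ^+ 2) <= E (supslope e) + e * poincare_error.
Proof.
move=> /andP[e0 e1].
have gs := egrowth_supslope e0.
have cpsi : scont psi := psi_egrowth.1.
have psi_le x : `|psi x| <= `|psi 0| + K * norm1 x by exact: lipschitz_bound.
have g1 : egrowth (fun x => expR (- (e * psi x))).
  apply: (@egrowth_expR _ _ _ `|psi 0| K) => //.
    by apply: scontN; apply: scontM => //; exact: scont_cst.
  move=> x; rewrite (le_trans (ler_norm _))// normrN normrM gtr0_norm//.
  by rewrite (le_trans _ (psi_le x))// ler_piMl.
have g2 : egrowth (fun x => expR (e * psi x - e ^+ 2 * supslope e x)).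
  apply: (@egrowth_expR _ _ _ `|psi 0| K) => //.
    apply: scontD; first by apply: scontM => //; exact: scont_cst.
    by apply: scontN; apply: scontM; [exact: scont_cst|exact: gs.1].
  move=> x; apply: (@le_trans _ _ (e * psi x)).
    by rewrite gerBl mulr_ge0 ?sqr_ge0//; case/andP: (supslope_bounds x e0).
  rewrite (le_trans (ler_norm _))// normrM gtr0_norm//.
  by rewrite (le_trans _ (psi_le x))// ler_piMl.
have PL : E (fun x => expR (- (e * psi x))) * E (fun x => expR (e * psi x - e ^+ 2 * supslope e x)) <= 1.
  rewrite /expect mulf_div -expr2 ler_pdivrMr ?exprn_gt0 ?rint_rapid_gt0// mul1r.
  apply: prekopa_leindler; [exact: rapid_gclass..|exact: rapid_gclass1| | |exact: W_gt0|].
  - by move=> x; rewrite mulr_gt0 ?expR_gt0.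
  - by move=> x; rewrite mulr_gt0 ?expR_gt0.
  move=> x y; apply: le_trans (W_mid x y).
  rewrite mulrACA -expRD ler_pM2l ?mulr_gt0// ler_expR.
  (* The direction [(x - y) / e] makes the displaced point equal to [x]. *)
  have := supslope_ge y (e^-1 *: (x - y)) e0.
  rewrite /slope scalerA divff ?gt_eqF// scale1r [y + _]addrC subrK enormZ gtr0_norm ?invr_gt0//.
  rewrite -(@ler_pM2l _ (e ^+ 2)) ?exprn_gt0//.
  have -> : e ^+ 2 * ((phi y - phi x) / e - (e^-1 * enorm (x - y)) ^+ 2 / (4 * s ^+ 2)) =
    e * psi y - e * psi x - enorm (x - y) ^+ 2 / (4 * s ^+ 2).
    by rewrite /psi; field; rewrite !gt_eqF.
  by lra.
have psi0 : E psi = 0.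
  by rewrite expectB ?expect_cst ?subrr//; [exact: egrowth_phi|exact: egrowth_cst].
(* This factor is bounded to first order only, the variance being extracted from the other one. The
   factor 2 in the Poincare constant is lost here: a second-order expansion of both would double the
   variance term. *)
have J : 1 <= E (fun x => expR (- (e * psi x))).
  have -> : 1 = E (fun x => 1 - e * psi x).
    rewrite expectB ?expect_cst//; [|exact: egrowth_cst|exact: egrowthZ].
    by rewrite expectZ// psi0 mulr0 subr0.
  apply: le_expect => //; last by move=> x; exact: expR_ge1Dx.
  by apply: egrowthB; [exact: egrowth_cst|exact: egrowthZ].
have U : E (fun x => expR (e * psi x - e ^+ 2 * supslope e x)) <= 1.
  apply: le_trans PL; rewrite ler_peMl// expect_ge0// => x; exact: expR_ge0.
have gq : egrowth (fun x => `|psi x| * B + 6^-1 * (`|psi x| + B) ^+ 3).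
  have gn := egrowth_norm psi_egrowth.
  apply: egrowthD; first by apply: egrowthM => //; exact: egrowth_cst.
  by apply: egrowthZ; apply: egrowthX; apply: egrowthD => //; exact: egrowth_cst.
have gp2 : egrowth (fun x => 2^-1 * psi x ^+ 2) by apply: egrowthZ; exact: egrowthX.
have gl1 := egrowthB (egrowthB gp2 gs) (egrowthZ e gq).
have gl : egrowth (fun x => 1 + e * psi x).
  by apply: egrowthD; [exact: egrowth_cst|exact: egrowthZ].
have := le_trans (le_expect rW W_gt0 (egrowthD gl (egrowthZ (e ^+ 2) gl1)) g2
  (fun x => expR_quadratic_lower (psi x) (introT andP (conj e0 e1)) (supslope_bounds x e0))) U.
rewrite expectD//; last exact: egrowthZ.
rewrite (expectD rW (egrowth_cst d 1)); last exact: egrowthZ.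
rewrite expect_cst// expectZ// psi0 mulr0 addr0 gerDl.
rewrite expectZ// pmulr_rle0 ?exprn_gt0//.
rewrite expectB//; [|exact: egrowthB|exact: egrowthZ].
rewrite expectB// (expectZ rW e gq) (@expectZ _ _ _ rW 2^-1 (fun x => psi x ^+ 2)); last exact: egrowthX.
by rewrite -/poincare_error -subr_ge0 => H; lra.
Qed.

End OneFunction.

Section Sum.
Variables (n : nat) (phi : 'I_n -> 'rV[R]_d -> R) (gam : 'I_n -> 'rV[R]_d -> 'rV[R]_d) (K : R).
Hypothesis K_ge0 : 0 <= K.
Hypothesis phi_lip : forall j x y, `|phi j x - phi j y| <= K * enorm (x - y).
Hypothesis phi_grad : forall j y (eta : R), 0 < eta -> exists2 del : R, 0 < del &
  forall v, enorm v <= del ->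
    `|phi j (y + v) - phi j y - dot (gam j y) v| <= eta * enorm v.
Hypothesis gam_le : forall y, \sum_(j < n) enorm (gam j y) ^+ 2 <= K ^+ 2.

Let r_ge0 : 0 <= 4 * s ^+ 2 * K.
Proof. by rewrite mulr_ge0// mulr_ge0// sqr_ge0. Qed.

(** For [|v| >= 4 s ^ 2 K] the Lipschitz bound already makes [slope] nonpositive. The remaining [v]
    are bounded, so for small [e] differentiability applies uniformly in [v], and completing the
    square gives [s ^ 2 |gam| ^ 2]. The [1 +] in the denominator of the threshold allows [K = 0]. *)
Lemma supslope_small j y (eta : R) : 0 < eta -> exists2 e0 : R, 0 < e0 &
  forall e, 0 < e <= e0 ->
    supslope (phi j) e y <= enorm (gam j y) ^+ 2 * s ^+ 2 + eta * (4 * s ^+ 2 * K).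
Proof.
move=> eta0; have [del del0 Hdel] := phi_grad j y eta0.
have r0 := r_ge0; set r := 4 * s ^+ 2 * K in r0 *.
have r1 : 0 < 1 + r by move: r0; clearbody r; lra.
exists (del / (1 + r)) => [|e /andP[e0 ed]]; first by rewrite divr_gt0.
apply: ge_sup; first by exists (slope (phi j) e y 0), 0.
move=> _ [v _ <-].
have rhs0 : 0 <= enorm (gam j y) ^+ 2 * s ^+ 2 + eta * r.
  by rewrite addr_ge0// mulr_ge0 ?sqr_ge0// ltW.
have [rv|vr] := leP r (enorm v).
  apply: le_trans rhs0; rewrite (le_trans (slope_le (phi_lip j) y v e0))//.
  have s4 : 0 < 4 * s ^+ 2 by rewrite mulr_gt0 ?exprn_gt0.
  rewrite subr_le0 ler_pdivlMr// (_ : K * enorm v * (4 * s ^+ 2) = r * enorm v); last by rewrite /r; ring.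
  by rewrite expr2 ler_wpM2r ?enorm_ge0.
have ev : enorm (e *: v) <= del.
  rewrite enormZ gtr0_norm//; move: ed; rewrite ler_pdivlMr// => ed.
  apply: le_trans ed; rewrite ler_pM2l// (le_trans (ltW vr))// lerDr; exact: ler01.
have := Hdel _ ev; rewrite enormZ (gtr0_norm e0) dotZr => H.
have {}H : (phi j y - phi j (y + e *: v)) / e <= - dot (gam j y) v + eta * enorm v.
  rewrite ler_pdivrMr//; move: H; rewrite ler_norml => /andP[H _]; lra.
have H1 : - dot (gam j y) v <= enorm (gam j y) * enorm v.
  by rewrite -dotNl (le_trans (dot_le _ _))// enormN.
have H2 : eta * enorm v <= eta * r by rewrite ler_pM2l// ltW.
have := quad_le (enorm (gam j y)) (enorm v).
rewrite /slope; lra.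
Qed.

(** Only an upper limit is controlled; the maximum with the target value turns it into a limit, the
    form that dominated convergence accepts. *)
Lemma sum_supslope_cvg (y : 'rV[R]_d) :
  Num.max (\sum_(j < n) supslope (phi j) k.+1%:R^-1 y) (K ^+ 2 * s ^+ 2) @[k --> \oo]
  --> K ^+ 2 * s ^+ 2.
Proof.
have S0 : 0 < n%:R * (4 * s ^+ 2 * K) + 1 by rewrite ltr_wpDl// mulr_ge0.
apply/cvgrPdist_le => /= eta eta0.
pose eta1 := eta / (n%:R * (4 * s ^+ 2 * K) + 1).
have eta1_gt0 : 0 < eta1 by rewrite divr_gt0.
have H j : \forall k \near \oo, supslope (phi j) k.+1%:R^-1 y <=
    enorm (gam j y) ^+ 2 * s ^+ 2 + eta1 * (4 * s ^+ 2 * K).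
  have [e0 e00 He] := supslope_small j y eta1_gt0.
  have := @near_infty_natSinv_lt R (PosNum e00); apply: filterS => k /= ke.
  by apply: He; rewrite invr_gt0 ltr0Sn ltW.
have {}H : \forall k \near \oo, forall j, supslope (phi j) k.+1%:R^-1 y <=
    enorm (gam j y) ^+ 2 * s ^+ 2 + eta1 * (4 * s ^+ 2 * K) by exact: filter_forall.
apply: filterS H => k Hk.
have Hs : \sum_(j < n) supslope (phi j) k.+1%:R^-1 y <= K ^+ 2 * s ^+ 2 + eta.
  apply: le_trans (ler_sum _ (fun j _ => Hk j)) _.
  rewrite big_split /= -mulr_suml sumr_const card_ord -(mulr_natl (eta1 * _) n) lerD//.
    by rewrite ler_wpM2r ?sqr_ge0.
  have -> : n%:R * (eta1 * (4 * s ^+ 2 * K)) = eta * (n%:R * (4 * s ^+ 2 * K)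
      / (n%:R * (4 * s ^+ 2 * K) + 1)) by rewrite /eta1; ring.
  by rewrite ler_piMr ?(ltW eta0)// ler_pdivrMr// mul1r lerDl.
rewrite distrC ger0_norm ?subr_ge0 ?le_max ?lexx ?orbT//.
by rewrite lerBlDr ge_max addrC Hs lerDl ltW.
Qed.

(** The sum over [j] is taken inside the expectation before [e = 1 / (k + 1)] tends to 0, so the
    pointwise bound [gam_le] applies to the whole family; treating each function separately would
    cost a factor [n]. *)
Lemma poincare_sum :
  \sum_(j < n) E (fun x => (phi j x - E (phi j)) ^+ 2) <= 2 * s ^+ 2 * K ^+ 2.
Proof.
pose D := \sum_(j < n) poincare_error (phi j) K.
pose M k x := Num.max (\sum_(j < n) supslope (phi j) k.+1%:R^-1 x) (K ^+ 2 * s ^+ 2).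
have k_gt0 k : 0 < k.+1%:R^-1 :> R by rewrite invr_gt0.
have maxE (x y : R) : Num.max x y = 2^-1 * (x + y + `|x - y|).
  by case: (ltrgt0P (x - y)) => h; [rewrite max_l|rewrite max_r|rewrite max_l]; lra.
have gsum k : egrowth (fun x => \sum_(j < n) supslope (phi j) k.+1%:R^-1 x).
  by apply: egrowth_sum => j; exact: (egrowth_supslope K_ge0 (phi_lip j)).
have gM k : egrowth (M k).
  rewrite /M; under eq_fun do rewrite maxE; apply: egrowthZ; apply: egrowthD.
    by apply: egrowthD => //; exact: egrowth_cst.
  by apply: egrowth_norm; apply: egrowthB => //; exact: egrowth_cst.
have Ecvg : E (M k) @[k --> \oo] --> K ^+ 2 * s ^+ 2.
  rewrite -[X in _ --> X](expect_cst rW W_gt0).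
  (* Each [supslope] is at most [K ^ 2 s ^ 2] uniformly in [k]; [n + 1] instead of [n] makes the
     constant dominate the other entry of the maximum even when [n = 0]. *)
  apply: (@expect_dct _ _ _ rW _ _ (n.+1%:R * (K ^+ 2 * s ^+ 2)) 0).
  - by move=> k; exact: (gM k).1.
  - exact: scont_cst.
  - move=> k x; rewrite mul0r expR0 mulr1.
    have B0 : 0 <= K ^+ 2 * s ^+ 2 by rewrite mulr_ge0 ?sqr_ge0.
    rewrite ger0_norm; last by rewrite /M le_max B0 orbT.
    rewrite /M ge_max -[X in _ && (X <= _)]mul1r ler_wpM2r ?ler1n// andbT.
    have hs : \sum_(j < n) supslope (phi j) k.+1%:R^-1 x <= \sum_(j < n) K ^+ 2 * s ^+ 2.
      apply: ler_sum => j _.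
      by have /andP[] := supslope_bounds (phi_lip j) x (k_gt0 k).
    rewrite sumr_const card_ord -(mulr_natl (K ^+ 2 * _) n) in hs.
    by rewrite (le_trans hs)// ler_wpM2r// ler_nat.
  - exact: sum_supslope_cvg.
have Dcvg : (E (M k) + k.+1%:R^-1 * D) @[k --> \oo] --> K ^+ 2 * s ^+ 2.
  rewrite -[X in _ --> X]addr0 -[X in _ + X](mul0r D); apply: cvgD => //.
  apply: cvgM; [exact: cvg_harmonic|exact: cvg_cst].
suff : 2^-1 * (\sum_(j < n) E (fun x => (phi j x - E (phi j)) ^+ 2)) <= K ^+ 2 * s ^+ 2 by lra.
apply: cvgr_to_ge Dcvg _; apply: nearW => k.
have k1 : (0 < (k.+1%:R^-1 : R)) && ((k.+1%:R^-1 : R) <= 1).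
  by apply/andP; split=> //; rewrite -[leRHS]invr1 lef_pV2 ?posrE ?ltr0Sn// ler1n.
rewrite mulr_sumr; apply: le_trans (ler_sum _ (fun j _ => var_le_supslope K_ge0 (phi_lip j) k1)) _.
rewrite big_split /= -mulr_sumr lerD2r -expect_sum//; last first.
  by move=> j; exact: (egrowth_supslope K_ge0 (phi_lip j)).
by apply: le_expect => // x; rewrite /M le_max lexx.
Qed.

End Sum.
End Poincare.

(** * Cocoercivity from one-sided convexity estimates *)

Section Nonexpansive.
Variables (R : realType) (d : nat) (m : 'rV[R]_d -> 'rV[R]_d) (psi : 'rV[R]_d -> R).
Hypothesis phi_sub : forall a b,
  psi a + 2^-1 * enorm a ^+ 2 + dot (m a) (b - a) <= psi b + 2^-1 * enorm b ^+ 2.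
Hypothesis psi_mid : forall a b, psi a + psi b <= 2 * psi (2^-1 *: (a + b)).
Hypothesis m_cont : forall a h, dot (m (a + 2^-1 ^+ n *: h)) h @[n --> \oo] --> dot (m a) h.

(** Midpoint concavity alone compares difference quotients only along the steps [2 ^ (- n)]. *)
Let psi_dyadic a h n : psi (a + h) - psi a <= 2 ^+ n * (psi (a + 2^-1 ^+ n *: h) - psi a).
Proof.
elim: n => [|n IH]; first by rewrite !expr0 scale1r mul1r.
apply: le_trans IH _; rewrite exprSr -mulrA ler_pM2l ?exprn_gt0//.
have := psi_mid a (a + 2^-1 ^+ n *: h).
have -> : 2^-1 *: (a + (a + 2^-1 ^+ n *: h)) = a + 2^-1 ^+ n.+1 *: h.
  by apply/rowP => i; rewrite !mxE exprS; field.
lra.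
Qed.

(** [m a - a] is a supergradient of [psi]: the subgradient inequality based at [a + t h] and
    evaluated at [a] bounds the dyadic quotient by [dot (m (a + t h)) h - dot a h], and [m_cont]
    lets [t] tend to 0. *)
Let psi_sup a b : psi b <= psi a + dot (m a - a) (b - a).
Proof.
have H h n : psi (a + h) - psi a <= dot (m (a + 2^-1 ^+ n *: h)) h - dot a h.
  apply: le_trans (psi_dyadic a h n) _.
  set t := 2^-1 ^+ n; have t0 : 0 < t by rewrite exprn_gt0.
  have -> : 2 ^+ n = t^-1 by rewrite /t exprVn invrK.
  rewrite mulrC ler_pdivrMr//.
  have := phi_sub (a + t *: h) a.
  rewrite opprD addNKr !sqr_enorm !dotE (dotC h a).
  by have := mulr_ge0 (sqr_ge0 t) (dot_ge0 h); lra.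
have := @cvgr_to_ge _ _ _ _ _ _ _ (cvgB (@m_cont a (b - a)) (cvg_cst (dot a (b - a))))
  (nearW _ (H (b - a))).
by rewrite [a + _]addrC subrK => Hab; rewrite [X in _ + X]dotDl dotNl -lerBlDl Hab.
Qed.

(** The Baillon-Haddad argument: [psi + |.|^2 / 2] is convex, and concave once [|.|^2 / 2] is
    removed, so its gradient map satisfies [|m a - m b| ^ 2 <= dot (m a - m b) (a - b)]. *)
Lemma cocoercive_nonexpansive a b : enorm (m a - m b) <= enorm (a - b).
Proof.
have H u v : psi u + 2^-1 * enorm u ^+ 2 + dot (m u) (v - u)
    + 2^-1 * enorm (m u - m v) ^+ 2 <= psi v + 2^-1 * enorm v ^+ 2.
  (* Lower bound from [u] and upper bound from [v], both at [v + D]; the best [D] is [m u - m v]. *)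
  have G D : psi u + 2^-1 * enorm u ^+ 2 + dot (m u) (v - u) + dot (m u) D - dot (m v) D
      - 2^-1 * dot D D <= psi v + 2^-1 * enorm v ^+ 2.
    have := phi_sub u (v + D); have := psi_sup v (v + D).
    rewrite [v + D - v]addrC addKr -[v + D - u]addrAC !sqr_enorm !dotE (dotC D v); lra.
  apply: le_trans (G (m u - m v)).
  rewrite -[_ + dot (m u) (m u - m v) - _]addrA -dotNl -dotDl !sqr_enorm; lra.
have := H a b; have := H b a.
rewrite -[enorm (m b - m a)]enormB => h1 h2.
have h3 : enorm (m a - m b) ^+ 2 <= dot (m a - m b) (a - b).
  by move: h1 h2; rewrite !dotE; lra.
have [->|n0] := eqVneq (enorm (m a - m b)) 0; first exact: enorm_ge0.
have n1 : 0 < enorm (m a - m b) by rewrite lt0r n0 enorm_ge0.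
by rewrite -(ler_pM2l n1) -expr2 (le_trans h3)// dot_le.
Qed.

End Nonexpansive.

(** * The Gaussian posterior weight and nonexpansiveness of its mean *)

Section GaussWeight.
Variables (R : realType) (d : nat) (p : 'rV[R]_d -> R) (s : R).
Hypothesis p_gt0 : forall x, 0 < p x.
Hypothesis p_growth : egrowth p.
Hypothesis p_mid : forall x y, p x * p y <= p (2^-1 *: (x + y)) ^+ 2.
Hypothesis s_gt0 : 0 < s.

Definition gaussW (z x : 'rV[R]_d) := p x * gauss s (z - x).

Let kappa : R := (Num.sqrt (2 * pi * s ^+ 2))^-1 ^+ d.

Let kappa_gt0 : 0 < kappa.
Proof. by rewrite exprn_gt0// invr_gt0 sqrtr_gt0 !mulr_gt0 ?pi_gt0 ?exprn_gt0. Qed.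

Let s2_gt0 : 0 < s ^+ 2. Proof. exact: exprn_gt0. Qed.

Lemma gaussWE z x : gaussW z x = kappa * (p x * expR (- (enorm (z - x) ^+ 2) / (2 * s ^+ 2))).
Proof. by rewrite /gaussW /gauss mulrCA. Qed.

Lemma gaussW_gt0 z x : 0 < gaussW z x.
Proof. by rewrite gaussWE !mulr_gt0 ?expR_gt0. Qed.

Lemma scont_sqr_enorm (z : 'rV[R]_d) : scont (fun x => enorm (z - x) ^+ 2).
Proof.
under eq_fun do rewrite sqr_enorm.
have c i : scont (fun x => (z - x) 0 i).
  move=> u x ux; rewrite !mxE; under eq_cvg do rewrite !mxE.
  by apply: cvgB; [exact: cvg_cst|exact: ux].
exact: scont_dot.
Qed.

Lemma scont_gaussW z : scont (gaussW z).
Proof.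
apply: scontM; first exact: p_growth.1.
apply: scontM; first exact: scont_cst.
apply: scont_comp; first exact: continuous_expR.
apply: scontM; last exact: scont_cst.
by apply: scontN; exact: scont_sqr_enorm.
Qed.

(** Uniform in [z] over a ball, so that one dominating function serves when [z] varies. The factor
    [d] in [k] converts the l1 norm to the Euclidean one, and [A] collects what is left after
    completing the square. *)
Lemma gaussW_bound (b r : R) : exists C, forall z x, norm1 z <= r ->
  `|gaussW z x| <= C * expR (- (b * norm1 x)).
Proof.
have [_ [C [c [c0 Cp]]]] := p_growth.
have C0 : 0 <= C by have := le_trans (normr_ge0 _) (Cp 0); rewrite pmulr_lge0 ?expR_gt0.
pose k := (c + `|b|) * d%:R.
pose A := (c + `|b|) * r + 2^-1 * k ^+ 2 * s ^+ 2.
exists (kappa * C * expR A) => z x zr.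
rewrite gtr0_norm ?gaussW_gt0// gaussWE -!mulrA ler_pM2l//.
apply: (@le_trans _ _ (C * expR (c * norm1 x) * expR (- (enorm (z - x) ^+ 2) / (2 * s ^+ 2)))).
  by rewrite ler_wpM2r ?expR_ge0// (le_trans (ler_norm _)).
rewrite -mulrA -!expRD ler_wpM2l// ler_expR.
set e := enorm (z - x).
have cb0 : 0 <= c + `|b| by rewrite addr_ge0.
have bx : b * norm1 x <= `|b| * norm1 x by rewrite ler_wpM2r ?norm1_ge0// ler_norm.
have Nx : norm1 x <= r + d%:R * e.
  have := norm1D z (x - z); rewrite addrC subrK => H.
  rewrite (le_trans H)// lerD// (le_trans (norm1_le_enorm _))// /e enormB//.
have H1 : (c + `|b|) * norm1 x <= (c + `|b|) * r + k * e.
  by rewrite /k -mulrA -mulrDr ler_wpM2l.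
have H2 : k * e - e ^+ 2 / (2 * s ^+ 2) <= 2^-1 * k ^+ 2 * s ^+ 2.
  have -> : k * e - e ^+ 2 / (2 * s ^+ 2) =
      2^-1 * k ^+ 2 * s ^+ 2 - 2^-1 * (k * s - e / s) ^+ 2.
    by field; rewrite gt_eqF.
  by rewrite gerBl mulr_ge0 ?sqr_ge0.
rewrite mulNr /A; lra.
Qed.

Lemma rapid_gaussW z : rapid (gaussW z).
Proof.
split=> [|b]; first exact: scont_gaussW.
by have [C HC] := gaussW_bound b (norm1 z); exists C => x; exact: HC.
Qed.

Lemma parallelogram (u v : 'rV[R]_d) : 2 * enorm (2^-1 *: (u + v)) ^+ 2 =
  enorm u ^+ 2 + enorm v ^+ 2 - 2^-1 * enorm (u - v) ^+ 2.
Proof. by rewrite !sqr_enorm !dotE (dotC v u); field. Qed.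

(** The Gaussian factor is an equality, by the parallelogram law; only [p_mid] loses. Taking [a = b]
    gives the strong midpoint inequality behind the Poincare estimate; letting [z] vary as well
    gives, by Prekopa-Leindler, concavity of the log partition function. *)
Lemma gaussW_mid2 a b x y :
  gaussW a x * gaussW b y * expR (enorm ((a - x) - (b - y)) ^+ 2 / (4 * s ^+ 2)) <=
  gaussW (2^-1 *: (a + b)) (2^-1 *: (x + y)) ^+ 2.
Proof.
rewrite !gaussWE; set u := a - x; set v := b - y.
have -> : 2^-1 *: (a + b) - 2^-1 *: (x + y) = 2^-1 *: (u + v).
  by rewrite -scalerBr /u /v addrACA -opprD.
have -> : kappa * (p x * expR (- enorm u ^+ 2 / (2 * s ^+ 2))) *
   (kappa * (p y * expR (- enorm v ^+ 2 / (2 * s ^+ 2)))) *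
   expR (enorm (u - v) ^+ 2 / (4 * s ^+ 2)) =
  kappa ^+ 2 * (p x * p y) * expR (- enorm u ^+ 2 / (2 * s ^+ 2) +
     - enorm v ^+ 2 / (2 * s ^+ 2) + enorm (u - v) ^+ 2 / (4 * s ^+ 2)).
  by rewrite !expRD; ring.
have A1 : 0 < kappa ^+ 2 * (p x * p y) by apply: mulr_gt0; [exact: exprn_gt0|exact: mulr_gt0].
rewrite !exprMn [leRHS]mulrA -expRM_natl.
apply: ler_pM; [exact: ltW|exact: expR_ge0|by apply: ler_wpM2l; [exact: sqr_ge0|exact: p_mid]|].
have P := parallelogram u v; rewrite ler_expR le_eqVlt; apply/orP; left; apply/eqP.
have -> : enorm (2^-1 *: (u + v)) ^+ 2 =
  2^-1 * (enorm u ^+ 2 + enorm v ^+ 2 - 2^-1 * enorm (u - v) ^+ 2) by move: P; lra.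
by field; rewrite gt_eqF.
Qed.

Lemma gaussW_mid z x y :
  gaussW z x * gaussW z y * expR (enorm (x - y) ^+ 2 / (4 * s ^+ 2)) <=
  gaussW z (2^-1 *: (x + y)) ^+ 2.
Proof.
have := gaussW_mid2 z z x y.
rewrite (_ : z - x - (z - y) = y - x); last by apply/rowP => i; rewrite !mxE; ring.
rewrite [enorm (y - x)]enormB (_ : 2^-1 *: (z + z) = z)//.
by apply/rowP => i; rewrite !mxE; field.
Qed.

Definition wmean (V : 'rV[R]_d -> R) : 'rV[R]_d := \row_i expect V (fun x => x 0 i).

Lemma egrowth_dot (u : 'rV[R]_d) : egrowth (fun x => dot x u).
Proof.
by apply: egrowth_sum => i; apply: egrowthM; [exact: egrowth_coord|exact: egrowth_cst].
Qed.

Lemma dot_wmean (V : 'rV[R]_d -> R) u : rapid V -> (forall x, 0 < V x) ->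
  dot (wmean V) u = expect V (fun x => dot x u).
Proof.
move=> rV V0; rewrite /dot expect_sum//; last first.
  by move=> i; apply: egrowthM; [exact: egrowth_coord|exact: egrowth_cst].
apply: eq_bigr => i _; rewrite mxE mulrC -expectZ//; last exact: egrowth_coord.
by congr expect; apply/funext => x; rewrite mulrC.
Qed.

Lemma mmse_wmean z : mmse p s z = wmean (gaussW z).
Proof.
have rz := rapid_gaussW z.
apply/rowP => i; rewrite !mxE /expect /psmooth iint_rint; last first.
  have := rapid_gclass rz (egrowth_coord R i).
  by under eq_fun do rewrite mulrC.
rewrite iint_rint; last exact: rapid_gclass1.
by congr (rint _ / _); apply/funext => x; rewrite mulrC.
Qed.

Lemma expect_jensen (V Y : 'rV[R]_d -> R) : rapid V -> (forall x, 0 < V x) ->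
  egrowth Y -> egrowth (fun x => expR (Y x)) ->
  expR (expect V Y) <= expect V (fun x => expR (Y x)).
Proof.
move=> rV V0 gY geY; set e := expect V Y.
have <- : expect V (fun x => expR e * (1 - e + Y x)) = expR e.
  rewrite expectZ//; last by apply: egrowthD => //; exact: egrowth_cst.
  rewrite expectD//; last exact: egrowth_cst.
  by rewrite expect_cst// subrK mulr1.
apply: le_expect => //.
  by apply: egrowthZ; apply: egrowthD => //; exact: egrowth_cst.
move=> x; have -> : expR (Y x) = expR e * expR (Y x - e) by rewrite -expRD addrC subrK.
rewrite ler_pM2l ?expR_gt0// (le_trans _ (expR_ge1Dx _))//; lra.
Qed.

Let Z z := rint (gaussW z).

Let Z_gt0 z : 0 < Z z.
Proof. by apply: rint_rapid_gt0 => [|x]; [exact: rapid_gaussW|exact: gaussW_gt0]. Qed.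

Let psi z := s ^+ 2 * ln (Z z).

Let psi_mid a b : psi a + psi b <= 2 * psi (2^-1 *: (a + b)).
Proof.
rewrite /psi -mulrDr mulrCA (ler_pM2l s2_gt0) -lnM ?posrE ?Z_gt0//.
have -> : 2 * ln (Z (2^-1 *: (a + b))) = ln (Z (2^-1 *: (a + b)) ^+ 2).
  by rewrite lnXn ?Z_gt0// mulr_natl.
rewrite ler_ln; [|by rewrite posrE mulr_gt0 ?Z_gt0|by rewrite posrE exprn_gt0 ?Z_gt0].
have g z : gclass (gaussW z) by apply: rapid_gclass1; exact: rapid_gaussW.
apply: prekopa_leindler => //; try by move=> x; exact: gaussW_gt0.
move=> x y; apply: le_trans (gaussW_mid2 a b x y).
apply: ler_peMr; first by apply/ltW/mulr_gt0; exact: gaussW_gt0.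
by rewrite -[leLHS]expR0 ler_expR divr_ge0 ?sqr_ge0// mulr_ge0 ?sqr_ge0.
Qed.

(** The terms quadratic in [x] cancel, so a change of [z] is an exponential tilt by an affine
    function of [x]. Jensen then turns the mean of that function into the subgradient inequality
    [phi_sub]. *)
Let tilt a b x : gaussW b x =
  gaussW a x * expR ((dot x (b - a) - 2^-1 * (enorm b ^+ 2 - enorm a ^+ 2)) / s ^+ 2).
Proof.
rewrite !gaussWE -!mulrA -expRD; congr (_ * (_ * expR _)).
by rewrite !sqr_enorm !dotE !(dotC _ x); field; rewrite gt_eqF.
Qed.

Let phi_sub a b : psi a + 2^-1 * enorm a ^+ 2 + dot (wmean (gaussW a)) (b - a)
  <= psi b + 2^-1 * enorm b ^+ 2.
Proof.
have ra := rapid_gaussW a; have a0 := gaussW_gt0 a.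
pose c := 2^-1 * (enorm b ^+ 2 - enorm a ^+ 2).
pose Y x := (dot x (b - a) - c) / s ^+ 2.
have gY : egrowth Y.
  apply: egrowthM; last exact: egrowth_cst.
  by apply: egrowthB; [exact: egrowth_dot|exact: egrowth_cst].
have geY : egrowth (fun x => expR (Y x)).
  apply: (@egrowth_expR _ _ _ (`|c| / s ^+ 2) (enorm (b - a) / s ^+ 2)).
  - exact: gY.1.
  - by rewrite divr_ge0 ?enorm_ge0 ?ltW.
  - move=> x; rewrite /Y mulrAC -mulrDl ler_pM2r ?invr_gt0// addrC lerD//.
      by rewrite (le_trans (ler_norm _))// normrN.
    by rewrite (le_trans (dot_le _ _))// mulrC ler_wpM2l ?enorm_ge0// enorm_le_norm1.
have ZE : Z b = Z a * expect (gaussW a) (fun x => expR (Y x)).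
  rewrite /expect mulrCA divff ?mulr1 ?gt_eqF ?Z_gt0//.
  by congr rint; apply/funext => x; rewrite (tilt a b).
have H := expect_jensen ra a0 gY geY.
have EY : expect (gaussW a) Y = (dot (wmean (gaussW a)) (b - a) - c) / s ^+ 2.
  have gd := egrowth_dot (b - a); have gc := egrowth_cst d c.
  have -> : Y = (fun x => (s ^+ 2)^-1 * (dot x (b - a) - c)).
    by apply/funext => x; rewrite /Y mulrC.
  rewrite (expectZ ra _ (egrowthB gd gc)) (expectB ra gd gc) (expect_cst ra a0).
  by rewrite -dot_wmean// mulrC.
have E0 := lt_le_trans (expR_gt0 _) H.
have : s ^+ 2 * expect (gaussW a) Y <= s ^+ 2 * ln (expect (gaussW a) (fun x => expR (Y x))).
  by rewrite ler_pM2l// -[leLHS]expRK ler_ln ?posrE ?expR_gt0.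
rewrite {1}EY mulrCA divff ?gt_eqF// mulr1 /psi ZE lnM ?posrE// mulrDr /c; lra.
Qed.

Let wmean_cont a h : dot (wmean (gaussW (a + 2^-1 ^+ n *: h))) h @[n --> \oo]
  --> dot (wmean (gaussW a)) h.
Proof.
pose z n := a + 2^-1 ^+ n *: h.
have half : (2^-1 : R) ^+ n @[n --> \oo] --> (0 : R).
  by apply: cvg_expr; rewrite gtr0_norm// invf_lt1// ltr1n.
have zr n : norm1 (z n) <= norm1 a + norm1 h.
  rewrite (le_trans (norm1D _ _))// lerD2l norm1Z ler_piMl ?norm1_ge0//.
  by rewrite ger0_norm ?exprn_ge0// exprn_ile1// invf_le1// ler1n.
have Wcvg x : gaussW (z n) x @[n --> \oo] --> gaussW a x.
  have cz : scont (fun z => gaussW z x).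
    under eq_fun do rewrite gaussWE.
    apply: scontM; first exact: scont_cst.
    apply: scontM; first exact: scont_cst.
    apply: scont_comp; first exact: continuous_expR.
    apply: scontM; last exact: scont_cst.
    apply: scontN; under eq_fun do rewrite enormB; exact: scont_sqr_enorm.
  apply: cz => i; rewrite -[a 0 i]addr0 -(mul0r (h 0 i)); under eq_cvg do rewrite !mxE.
  by apply: cvgD; [exact: cvg_cst|apply: cvgM => //; exact: cvg_cst].
have dct (f : 'rV[R]_d -> R) : egrowth f ->
    rint (fun x => gaussW (z n) x * f x) @[n --> \oo] --> rint (fun x => gaussW a x * f x).
  move=> [cf [C [b [b0 Cf]]]].
  have [D HD] := gaussW_bound (b + 1) (norm1 a + norm1 h).
  apply: (@rint_dct _ _ _ _ (D * C)).
  - by move=> n; apply: scontM => //; exact: scont_gaussW.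
  - by apply: scontM => //; exact: scont_gaussW.
  - move=> n x.
    rewrite normrM (_ : - norm1 x = - ((b + 1) * norm1 x) + b * norm1 x); last by ring.
    by rewrite expRD mulrACA ler_pM// HD.
  - by move=> x; apply: cvgM => //; exact: cvg_cst.
rewrite dot_wmean; [|exact: rapid_gaussW|exact: gaussW_gt0].
under eq_cvg => n.
  rewrite dot_wmean; [|exact: rapid_gaussW|exact: gaussW_gt0]; over.
apply: cvgM; first by apply: dct; exact: egrowth_dot.
apply: cvgV; first by rewrite gt_eqF// Z_gt0.
have := dct _ (egrowth_cst d 1).
rewrite (_ : (fun n => rint _) = (fun n => Z (z n))); last first.
  by apply/funext => n; congr rint; apply/funext => x; rewrite mulr1.
by rewrite (_ : rint _ = Z a)//; congr rint; apply/funext => x; rewrite mulr1.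
Qed.

Lemma mmse_nonexpansive a b : enorm (mmse p s a - mmse p s b) <= enorm (a - b).
Proof. by rewrite !mmse_wmean; exact: cocoercive_nonexpansive phi_sub psi_mid wmean_cont a b. Qed.

End GaussWeight.

Lemma row_subE (R : realType) d (x y : 'rV[R]_d) j : (x - y) 0 j = x 0 j - y 0 j.
Proof. by rewrite !mxE. Qed.

Lemma lipschitz_of_line (R : realType) d (f : 'rV[R]_d -> R) (gam : 'rV[R]_d -> 'rV[R]_d) K :
  (forall x v (t : R), is_derive t 1 (fun r => f (x + r *: v)) (dot (gam (x + t *: v)) v)) ->
  (forall x, enorm (gam x) <= K) -> forall x y, `|f x - f y| <= K * enorm (x - y).
Proof.
move=> df gK x y; have dl := df y (x - y).
have [c _] := MVT_segment ler01 (fun t _ => dl t) (is_derive_within dl).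
rewrite scale1r scale0r addr0 [y + _]addrC subrK subr0 mulr1 => ->.
by rewrite (le_trans (normr_dot_le _ _))// ler_wpM2r ?enorm_ge0.
Qed.

(** * The gap between the mean of a function and its value at the mean *)

Section ExpectTaylor.
Variables (R : realType) (d : nat) (W : 'rV[R]_d -> R) (s : R).
Hypothesis rW : rapid W.
Hypothesis W_gt0 : forall x, 0 < W x.
Hypothesis s_gt0 : 0 < s.
Hypothesis W_mid : forall x y,
  W x * W y * expR (enorm (x - y) ^+ 2 / (4 * s ^+ 2)) <= W (2^-1 *: (x + y)) ^+ 2.
Local Notation E := (expect W).

(** The best weight is [l = b / a]; adding [eta] to both terms keeps it meaningful when one
    vanishes. With it, Cauchy-Schwarz for expectations reduces to a pointwise inequality. *)
Lemma le_2mul_of_weighted (A a b : R) : 0 <= a -> 0 <= b ->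
  (forall l, 0 < l -> A <= l * a ^+ 2 + b ^+ 2 / l) -> A <= 2 * a * b.
Proof.
move=> a0 b0 H; apply/ler_addgt0Pr => e e0.
pose eta := e / (a + b + 1).
have ab1 : 0 < a + b + 1 by lra.
have eta0 : 0 < eta by rewrite divr_gt0.
have ae : 0 < a + eta by lra.
have be : 0 < b + eta by lra.
apply: le_trans (H ((b + eta) / (a + eta)) _) _; first by rewrite divr_gt0.
have h1 : (b + eta) / (a + eta) * a ^+ 2 <= (b + eta) * a.
  rewrite expr2 mulrA ler_wpM2r// -mulrA ler_piMr ?(ltW be)// mulrC ler_pdivrMr// mul1r; lra.
have h2 : b ^+ 2 / ((b + eta) / (a + eta)) <= (a + eta) * b.
  rewrite invf_div mulrC -mulrA ler_wpM2l ?(ltW ae)// mulrC ler_pdivrMr// expr2 ler_wpM2l//; lra.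
have h3 : eta * (a + b) <= e.
  rewrite /eta mulrAC ler_pdivrMr// ler_pM2l//; lra.
lra.
Qed.

(** The coordinates have gradients [evec R j], with squares summing to [d], hence [K = sqrt d]. It
    is also a Lipschitz constant of each coordinate, since an index [j] forces [d >= 1]. *)
Lemma sum_var_coord :
  \sum_(j < d) E (fun x => (x 0 j - wmean W 0 j) ^+ 2) <= 2 * s ^+ 2 * d%:R.
Proof.
have d0 : 0 <= d%:R :> R by [].
have K0 : 0 <= Num.sqrt d%:R :> R by exact: sqrtr_ge0.
have e1 (j : 'I_d) : enorm (evec R j) ^+ 2 = 1.
  rewrite sqr_enorm /dot (bigD1 j)//= big1 ?addr0 => [|i ij].
    by rewrite /evec mxE !eqxx mulr1.
  by rewrite /evec mxE eqxx (negbTE ij) mulr0.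
have := @poincare_sum R d W s rW W_gt0 s_gt0 W_mid d (fun j x => x 0 j)
  (fun j _ => evec R j) (Num.sqrt d%:R) K0.
rewrite sqr_sqrtr// => H.
have -> : \sum_(j < d) E (fun x => (x 0 j - wmean W 0 j) ^+ 2) =
    \sum_(j < d) E (fun x => (x 0 j - E (fun x => x 0 j)) ^+ 2).
  by apply: eq_bigr => j _; rewrite mxE.
apply: H => [j x y|j y eta eta0|_].
- have -> : x 0 j - y 0 j = (x - y) 0 j by rewrite !mxE.
  rewrite (le_trans (enorm_coord _ _))// ler_peMl ?enorm_ge0//.
  rewrite -[leLHS]sqrtr1 ler_wsqrtr// ler1n; exact: leq_ltn_trans (ltn_ord j).
- exists 1 => // v _.
  have -> : dot (evec R j) v = v 0 j.
    rewrite /dot (bigD1 j)//= big1 ?addr0 => [|i ij]; first by rewrite /evec mxE !eqxx mul1r.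
    by rewrite /evec mxE eqxx (negbTE ij) mul0r.
  by rewrite mxE [_ + v 0 j]addrC addrK subrr normr0 mulr_ge0 ?enorm_ge0 ?ltW.
- by under eq_bigr do rewrite e1; rewrite sumr_const card_ord.
Qed.

Variables (h : 'rV[R]_d -> R) (phi : 'I_d -> 'rV[R]_d -> R).
Variables (gam : 'I_d -> 'rV[R]_d -> 'rV[R]_d) (K : R).
Hypothesis K_ge0 : 0 <= K.
Hypothesis h_scont : scont h.
Hypothesis h_line : forall x v (t : R),
  is_derive t 1 (fun r => h (x + r *: v)) (\sum_(j < d) phi j (x + t *: v) * v 0 j).
Hypothesis phi_lip : forall j x y, `|phi j x - phi j y| <= K * enorm (x - y).
Hypothesis phi_grad : forall j y (eta : R), 0 < eta -> exists2 del : R, 0 < del &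
  forall v, enorm v <= del ->
    `|phi j (y + v) - phi j y - dot (gam j y) v| <= eta * enorm v.
Hypothesis gam_le : forall y, \sum_(j < d) enorm (gam j y) ^+ 2 <= K ^+ 2.

Lemma egrowth_of_line : egrowth h.
Proof.
pose F (x : 'rV[R]_d) := `|h 0| + norm1 x * (\sum_(j < d) `|phi j 0| + K * norm1 x).
have gF : egrowth F.
  apply: egrowthD; first exact: egrowth_cst.
  apply: egrowthM; first exact: egrowth_norm1.
  by apply: egrowthD; [exact: egrowth_cst|apply: egrowthZ; exact: egrowth_norm1].
apply: (egrowth_le h_scont gF) => x.
have [c] := MVT_segment ler01 (fun t _ => h_line 0 x t) (is_derive_within (h_line 0 x)).
rewrite in_itv /= => /andP[c0 c1]; rewrite scale1r scale0r addr0 add0r subr0 mulr1 => hx.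
rewrite -[h x](subrK (h 0)) hx addrC (le_trans (ler_normD _ _))// lerD2l.
rewrite (le_trans (ler_norm_sum _ _ _))//.
rewrite mulrC {2}/norm1 mulr_sumr ler_sum// => j _; rewrite normrM ler_wpM2r//.
rewrite (le_trans (lipschitz_bound (phi_lip j) K_ge0 _))// lerD//.
  by rewrite (bigD1 j)//= lerDl sumr_ge0.
by rewrite ler_wpM2l// add0r norm1Z ler_piMl ?norm1_ge0// ger0_norm.
Qed.

Let m := wmean W.

(** As [x - m] has mean zero, each [phi j] may be centred, leaving covariances. Composing with the
    contraction towards [m] multiplies gradients by [t], so the Poincare inequality applies with
    [K * t]. *)
Lemma expect_cov_le (t : R) : 0 <= t <= 1 ->
  E (fun x => \sum_(j < d) phi j (m + t *: (x - m)) * (x - m) 0 j)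
  <= 2 * s ^+ 2 * (K * t) * Num.sqrt d%:R.
Proof.
move=> /andP[t0 t1].
have Kt0 : 0 <= K * t by rewrite mulr_ge0.
pose f j x := phi j (m + t *: (x - m)).
have f_lip j x y : `|f j x - f j y| <= K * t * enorm (x - y).
  rewrite (le_trans (phi_lip _ _ _))// -mulrA ler_wpM2l//.
  have -> : m + t *: (x - m) - (m + t *: (y - m)) = t *: (x - y).
    by apply/rowP => i; rewrite !mxE; ring.
  by rewrite enormZ ger0_norm.
have P := @poincare_sum R d W s rW W_gt0 s_gt0 W_mid d f
  (fun j x => t *: gam j (m + t *: (x - m))) (K * t) Kt0 f_lip.
have {}P : \sum_(j < d) E (fun x => (f j x - E (f j)) ^+ 2) <= 2 * s ^+ 2 * (K * t) ^+ 2.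
  apply: P => [j y eta eta0|y].
  - have [del del0 Hdel] := phi_grad j (m + t *: (y - m)) eta0.
    exists del => // v vd.
    have tv : enorm (t *: v) <= enorm v by rewrite enormZ ger0_norm// ler_piMl ?enorm_ge0.
    have := Hdel _ (le_trans tv vd).
    rewrite /f dotZl dotZr.
    have -> : m + t *: (y + v - m) = m + t *: (y - m) + t *: v.
      by apply/rowP => i; rewrite !mxE; ring.
    by move/le_trans; apply; rewrite ler_pM2l.
  - under eq_bigr do rewrite enormZ exprMn.
    by rewrite -mulr_sumr exprMn mulrC real_normK ?num_real// ler_wpM2r ?sqr_ge0.
have gf j : egrowth (f j) by apply: lipschitz_egrowth (f_lip j) Kt0.
have gY j : egrowth (fun x : 'rV[R]_d => x 0 j - m 0 j).
  by apply: egrowthB; [exact: egrowth_coord|exact: egrowth_cst].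
have EY j : E (fun x : 'rV[R]_d => x 0 j - m 0 j) = 0.
  rewrite expectB//; [|exact: egrowth_coord|exact: egrowth_cst].
  by rewrite expect_cst// /m /wmean mxE subrr.
have gc j : egrowth (fun x => f j x - E (f j)) by apply: egrowthB => //; exact: egrowth_cst.
have -> : E (fun x => \sum_(j < d) phi j (m + t *: (x - m)) * (x - m) 0 j) =
    E (fun x => \sum_(j < d) (f j x - E (f j)) * (x 0 j - m 0 j)).
  rewrite !expect_sum//; first last.
  - by move=> j; under eq_fun do rewrite row_subE; exact: (egrowthM (gf j) (gY j)).
  - by move=> j; exact: (egrowthM (gc j) (gY j)).
  apply: eq_bigr => j _.
  have -> : (fun x => phi j (m + t *: (x - m)) * (x - m) 0 j) =
     (fun x => (f j x - E (f j)) * (x 0 j - m 0 j) + E (f j) * (x 0 j - m 0 j)).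
    by apply/funext => x; rewrite row_subE -mulrDl subrK.
  rewrite expectD//; [|exact: egrowthM|exact: egrowthZ].
  by rewrite (expectZ rW (E (f j)) (gY j)) EY mulr0 addr0.
have -> : 2 * s ^+ 2 * (K * t) * Num.sqrt d%:R = 2 * (s * (K * t)) * (s * Num.sqrt d%:R) by ring.
apply: le_2mul_of_weighted; [by rewrite mulr_ge0 ?(ltW s_gt0)|by rewrite mulr_ge0 ?sqrtr_ge0 ?(ltW s_gt0)|].
move=> l l0.
pose G1 x := \sum_(j < d) (f j x - E (f j)) ^+ 2.
pose G2 (x : 'rV[R]_d) := \sum_(j < d) (x 0 j - m 0 j) ^+ 2.
have g1 : egrowth G1 by apply: egrowth_sum => j; exact: egrowthX.
have g2 : egrowth G2 by apply: egrowth_sum => j; exact: egrowthX.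
have E1 : E G1 <= 2 * s ^+ 2 * (K * t) ^+ 2.
  by rewrite expect_sum// => j; exact: egrowthX.
have E2 : E G2 <= 2 * s ^+ 2 * d%:R.
  rewrite expect_sum//; last by move=> j; exact: egrowthX.
  exact: sum_var_coord.
apply: (@le_trans _ _ (E (fun x => 2^-1 * l * G1 x + (2 * l)^-1 * G2 x))).
  apply: le_expect => //.
  - by apply: egrowth_sum => j; exact: egrowthM.
  - by apply: egrowthD; exact: egrowthZ.
  move=> x; rewrite /G1 /G2 !mulr_sumr -big_split /=; apply: ler_sum => j _.
  move: (f j x - _) (x 0 j - _) => a b; rewrite -subr_ge0.
  have -> : 2^-1 * l * a ^+ 2 + (2 * l)^-1 * b ^+ 2 - a * b = (l * a - b) ^+ 2 / (2 * l).
    by field; rewrite gt_eqF.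
  by rewrite divr_ge0 ?sqr_ge0// mulr_ge0 ?ltW.
rewrite expectD ?expectZ//; [|exact: egrowthZ..].
have -> : l * (s * (K * t)) ^+ 2 + (s * Num.sqrt d%:R) ^+ 2 / l =
    2^-1 * l * (2 * s ^+ 2 * (K * t) ^+ 2) + (2 * l)^-1 * (2 * s ^+ 2 * d%:R).
  by rewrite !exprMn (sqr_sqrtr (ler0n R d)); field; rewrite gt_eqF.
by rewrite lerD// ler_wpM2l// ?invr_ge0 mulr_ge0 ?invr_ge0// ltW.
Qed.

(** The crude [K * d] is harmless: the errors of [N] steps of length [1 / N] add up to order
    [1 / N]. *)
Lemma line_step (x : 'rV[R]_d) (t e : R) : 0 < e ->
  h (m + (t + e) *: (x - m)) - h (m + t *: (x - m)) <=
  e * (\sum_(j < d) phi j (m + t *: (x - m)) * (x - m) 0 j)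
  + e ^+ 2 * (K * d%:R) * enorm (x - m) ^+ 2.
Proof.
move=> e0; set v := x - m.
have te : t <= t + e by rewrite lerDl ltW.
have [c] := MVT_segment te (fun t _ => h_line m v t) (is_derive_within (h_line m v)).
rewrite in_itv /= => /andP[c0 c1] ->.
rewrite [t + e - t]addrAC subrr add0r mulrC expr2 -!mulrA -mulrDr ler_pM2l//.
have -> : e * (K * (d%:R * enorm v ^+ 2)) = \sum_(j < d) (K * (e * enorm v) * enorm v).
  by rewrite sumr_const card_ord -(mulr_natl (K * _ * _) d); ring.
rewrite -big_split /=; apply: ler_sum => j _.
rewrite -lerBlDl -mulrBl (le_trans (ler_norm _))// normrM.
rewrite ler_pM//; last exact: enorm_coord.
rewrite (le_trans (phi_lip _ _ _))// ler_wpM2l//.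
have -> : m + c *: v - (m + t *: v) = (c - t) *: v.
  by apply/rowP => i; rewrite !mxE; ring.
rewrite enormZ ler_wpM2r ?enorm_ge0// ger0_norm ?subr_ge0//; lra.
Qed.

Lemma expect_taylor : E h - h m <= s ^+ 2 * K * Num.sqrt d%:R.
Proof.
have gh := egrowth_of_line.
pose V := E (fun x => enorm (x - m) ^+ 2).
have gV : egrowth (fun x : 'rV[R]_d => enorm (x - m) ^+ 2).
  under eq_fun do rewrite sqr_enorm.
  have gY j : egrowth (fun x : 'rV[R]_d => (x - m) 0 j).
    under eq_fun do rewrite row_subE.
    by apply: egrowthB; [exact: egrowth_coord|exact: egrowth_cst].
  by apply: egrowth_sum => j; exact: egrowthM.
have V0 : 0 <= V by apply: expect_ge0 => // x; exact: sqr_ge0.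
have step (N : nat) : (0 < N)%N ->
    E h - h m <= s ^+ 2 * K * Num.sqrt d%:R + K * d%:R * V / N%:R.
  move=> N0; have NR : 0 < N%:R :> R by rewrite ltr0n.
  pose a (i : nat) := E (fun x => h (m + (i%:R / N%:R) *: (x - m))).
  have ga t : egrowth (fun x => h (m + t *: (x - m))) by exact: egrowth_affine.
  have aN : a N = E h.
    rewrite /a divff ?gt_eqF//; congr expect; apply/funext => x.
    by rewrite scale1r addrC subrK.
  have a0 : a 0%N = h m.
    by rewrite /a mul0r; under eq_fun do rewrite scale0r addr0; rewrite expect_cst.
  rewrite -aN -a0 -(telescope_sumr _ (leq0n N)).
  apply: (@le_trans _ _ (\sum_(0 <= i < N)
    (N%:R^-1 * (2 * s ^+ 2 * (K * (i%:R / N%:R)) * Num.sqrt d%:R) + N%:R^-1 ^+ 2 * (K * d%:R) * V))).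
    rewrite !big_nat; apply: ler_sum => i /andP[_ iN].
    set t := i%:R / N%:R.
    have t01 : 0 <= t <= 1.
      by rewrite divr_ge0//= ler_pdivrMr// mul1r ler_nat ltnW.
    have ti : i.+1%:R / N%:R = t + N%:R^-1 by rewrite /t -natr1 mulrDl mul1r.
    pose S x := \sum_(j < d) phi j (m + t *: (x - m)) * (x - m) 0 j.
    have gS : egrowth S.
      apply: egrowth_sum => j; apply: egrowthM.
        apply: (@egrowth_affine _ _ (phi j)); exact: lipschitz_egrowth (phi_lip j) K_ge0.
      under eq_fun do rewrite row_subE.
      by apply: egrowthB; [exact: egrowth_coord|exact: egrowth_cst].
    rewrite /a ti -expectB//.
    apply: (@le_trans _ _ (E (fun x => N%:R^-1 * S x + N%:R^-1 ^+ 2 * (K * d%:R) * enorm (x - m) ^+ 2))).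
      apply: le_expect => //; first exact: egrowthB.
        by apply: egrowthD; exact: egrowthZ.
      by move=> x; apply: line_step; rewrite invr_gt0.
    rewrite expectD; [|exact: rW|exact: egrowthZ|exact: egrowthZ].
    rewrite (expectZ rW _ gS) (expectZ rW _ gV) lerD2r ler_pM2l ?invr_gt0//.
    exact: expect_cov_le.
  rewrite big_split /= sumr_const_nat subn0 lerD//.
  (* The sum is twice a left Riemann sum of [t] over the unit interval, hence at most 1: this
     absorbs the 2 of the Poincare inequality. *)
  - have -> : \sum_(0 <= i < N) N%:R^-1 * (2 * s ^+ 2 * (K * (i%:R / N%:R)) * Num.sqrt d%:R) =
       s ^+ 2 * K * Num.sqrt d%:R * (2 * (\sum_(0 <= i < N) i%:R) / N%:R ^+ 2).
      rewrite !(mulr_sumr, mulr_suml); apply: eq_bigr => i _.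
      by field; rewrite gt_eqF.
    rewrite ler_piMr//; first by rewrite mulr_ge0 ?sqrtr_ge0// mulr_ge0// sqr_ge0.
    rewrite ler_pdivrMr ?exprn_gt0// mul1r -natr_sum -natrM -natrX ler_nat.
    elim: (N) => [|k IH]; first by rewrite big_geq.
    by rewrite big_nat_recr//= mulnDr (leq_trans (leq_add IH (leqnn _)))// !expnS !expn0; nia.
  - rewrite -(mulr_natl (_ * V) N) le_eqVlt; apply/orP; left; apply/eqP.
    by field; rewrite gt_eqF.
apply/ler_addgt0Pr => e e0.
pose C := K * d%:R * V.
near \oo => N.
have N0 : (0 < N)%N by near: N; exists 1%N.
have NR : 0 < N%:R :> R by rewrite ltr0n.
apply: le_trans (step N N0) _; rewrite lerD2l ler_pdivrMr// -ler_pdivrMl//.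
by near: N; exact: nbhs_infty_ger.
Unshelve. all: end_near. Qed.

End ExpectTaylor.

(** * Distance between the posterior mean and the posterior mode *)

Section MapBound.
Variables (R : realType) (d : nat) (p : 'rV[R]_d -> R) (s : R).
Hypothesis p_gt0 : forall x, 0 < p x.
Hypothesis p_growth : egrowth p.
Hypothesis p_mid : forall x y, p x * p y <= p (2^-1 *: (x + y)) ^+ 2.
Hypothesis s_gt0 : 0 < s.
Variable g : 'rV[R]_d -> 'rV[R]_d.
Hypothesis p_tangent : forall x y, p y <= p x * expR (dot (g x) (y - x)).
Hypothesis g_growth : forall i, egrowth (fun x => g x 0 i).

Let score z x := g x + (s ^+ 2)^-1 *: (z - x).

Let gaussW_tangent z x y :
  gaussW p s z y <= gaussW p s z x * expR (dot (score z x) (y - x)).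
Proof.
rewrite !gaussWE; set kap := (_ ^-1 ^+ d).
have k0 : 0 < kap.
  by rewrite exprn_gt0// invr_gt0 sqrtr_gt0 !mulr_gt0 ?pi_gt0 ?exprn_gt0.
rewrite -!mulrA (ler_pM2l k0) -expRD.
apply: le_trans (ler_wpM2r (expR_ge0 _) (p_tangent x y)) _.
rewrite -mulrA (ler_pM2l (p_gt0 x)) -expRD ler_expR /score dotDl addrCA lerD2l.
rewrite dotZl -subr_ge0.
have -> : - enorm (z - x) ^+ 2 / (2 * s ^+ 2) + (s ^+ 2)^-1 * dot (z - x) (y - x)
    - - enorm (z - y) ^+ 2 / (2 * s ^+ 2) = enorm (x - y) ^+ 2 / (2 * s ^+ 2).
  by rewrite !sqr_enorm !dotE (dotC y x) (dotC x z) (dotC y z); field; rewrite gt_eqF.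
by rewrite divr_ge0 ?sqr_ge0// mulr_ge0 ?sqr_ge0.
Qed.

Let score_growth z v : egrowth (fun x => dot (score z x) v).
Proof.
apply: egrowth_sum => i; apply: egrowthM; last exact: egrowth_cst.
have -> : (fun x => score z x 0 i) = (fun x => g x 0 i + (s ^+ 2)^-1 * (z 0 i - x 0 i)).
  by apply/funext => x; rewrite /score !mxE.
apply: egrowthD => //; apply: egrowthZ.
by apply: egrowthB; [exact: egrowth_cst|exact: egrowth_coord].
Qed.

(* [\int W (x + e v) dx = \int W x dx] and the tangent inequality at [x + e v] give
   [E <score (x + e v), v> <= 0]; then [e -> 0]. *)
Let score_le z v : expect (gaussW p s z) (fun x => dot (score z x) v) <= 0.
Proof.
set W := gaussW p s z; set F := fun x => dot (score z x) v.
have rW : rapid W by exact: rapid_gaussW.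
have W0 x : 0 < W x by exact: gaussW_gt0.
have gF : egrowth F by exact: score_growth.
have [cF [C [b [b0 CF]]]] := gF.
have C0 : 0 <= C by have := le_trans (normr_ge0 _) (CF 0); rewrite pmulr_lge0 ?expR_gt0.
pose e (n : nat) : R := n.+1%:R^-1.
have e0 n : 0 < e n by rewrite invr_gt0.
have e1 n : e n <= 1 by rewrite -[leRHS]invr1 lef_pV2 ?posrE ?ltr0Sn// ler1n.
pose Fe n x := F (x + e n *: v).
have cFe n : scont (Fe n).
  move=> u x ux; apply: cF => i; rewrite !mxE; under eq_cvg do rewrite !mxE.
  by apply: cvgD; [exact: ux|exact: cvg_cst].
have FeC n x : `|Fe n x| <= C * expR (b * norm1 v) * expR (b * norm1 x).
  rewrite (le_trans (CF _))// -mulrA ler_wpM2l// -expRD ler_expR -mulrDr ler_wpM2l//.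
  rewrite (le_trans (norm1D _ _))// addrC lerD2r norm1Z ler_piMl ?norm1_ge0//.
  by rewrite gtr0_norm.
have gFe n : egrowth (Fe n) by split=> //; exists (C * expR (b * norm1 v)), b.
have cvgE : expect W (Fe n) @[n --> \oo] --> expect W F.
  apply: (expect_dct rW cFe cF FeC) => x; apply: cF => i.
  rewrite -[x 0 i]addr0 -(mul0r (v 0 i)); under eq_cvg do rewrite !mxE.
  by apply: cvgD; [exact: cvg_cst|apply: cvgM; [exact: cvg_harmonic|exact: cvg_cst]].
apply: cvgr_to_le cvgE _; apply: nearW => n.
have gW : gclass W by exact: rapid_gclass1.
have H : rint (fun x => W x * (1 + e n * Fe n x)) <= rint W.
  rewrite -(rint_shift (e n *: v) gW); last by move=> x; exact: ltW.
  apply: le_rint.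
  - by apply: rapid_gclass => //; apply: egrowthD; [exact: egrowth_cst|exact: egrowthZ].
  - exact: gclass_shift.
  move=> x; set y := x + e n *: v.
  apply: (@le_trans _ _ (W x * expR (e n * F y))).
    by rewrite ler_pM2l ?expR_ge1Dx.
  have := gaussW_tangent z y x; rewrite -/W.
  have -> : x - y = - (e n *: v) by rewrite /y opprD addNKr.
  rewrite dotNr dotZr -/(F y) expRN => T.
  by rewrite -ler_pdivlMr ?expR_gt0.
have W1 : 0 < rint W by exact: rint_rapid_gt0.
have : expect W (fun x => 1 + e n * Fe n x) <= 1 by rewrite /expect ler_pdivrMr// mul1r.
rewrite expectD//; [|exact: egrowth_cst|exact: egrowthZ].
rewrite expect_cst// expectZ// gerDl pmulr_rle0//.
Qed.

(** [score_le] at [v] and at [- v] forces the score to have mean zero, which is integration by parts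
    without boundary terms. *)
Lemma expect_grad z v :
  expect (gaussW p s z) (fun x => dot (g x) v) = dot (wmean (gaussW p s z) - z) v / s ^+ 2.
Proof.
have rW : rapid (gaussW p s z) by exact: rapid_gaussW.
have W0 x : 0 < gaussW p s z x by exact: gaussW_gt0.
have S0 : expect (gaussW p s z) (fun x => dot (score z x) v) = 0.
  apply/eqP; rewrite eq_le score_le /= -oppr_le0 -expectN//.
  have := score_le z (- v); congr (_ <= _); congr expect; apply/funext => x.
  by rewrite dotNr.
have gd : egrowth (fun x => dot x v) by exact: egrowth_dot.
have -> : (fun x => dot (g x) v) =
    (fun x => dot (score z x) v + ((s ^+ 2)^-1 * dot x v - (s ^+ 2)^-1 * dot z v)).
  by apply/funext => x; rewrite /score !dotE; ring.
rewrite expectD//; last by apply: egrowthB; [exact: egrowthZ|exact: egrowth_cst].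
rewrite S0 add0r expectB//; [|exact: egrowthZ|exact: egrowth_cst].
by rewrite expectZ// expect_cst// -dot_wmean// dotDl dotNl; ring.
Qed.

Variables (H : 'I_d -> 'I_d -> 'rV[R]_d -> R) (T : 'I_d -> 'I_d -> 'rV[R]_d -> 'rV[R]_d) (M : R).
Hypothesis M_ge0 : 0 <= M.
Hypothesis g_line : forall k x v (t : R),
  is_derive t 1 (fun r => g (x + r *: v) 0 k) (\sum_(j < d) H j k (x + t *: v) * v 0 j).
Hypothesis H_line : forall j k x v (t : R),
  is_derive t 1 (fun r => H j k (x + r *: v)) (dot (T j k (x + t *: v)) v).
Hypothesis H_grad : forall j k y (eta : R), 0 < eta -> exists2 del : R, 0 < del &
  forall v, enorm v <= del ->
    `|H j k (y + v) - H j k y - dot (T j k y) v| <= eta * enorm v.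
Hypothesis T_le : forall y, \sum_(j < d) \sum_(k < d) enorm (T j k y) ^+ 2 <= M ^+ 2.

Section Direction.
Variable w : 'rV[R]_d.
Let phi j x := \sum_(k < d) w 0 k * H j k x.
Let gam j x : 'rV[R]_d := \sum_(k < d) w 0 k *: T j k x.

Let gamE j x i : gam j x 0 i = \sum_(k < d) w 0 k * T j k x 0 i.
Proof. by rewrite summxE; apply: eq_bigr => k _; rewrite mxE. Qed.

Let dot_gam j x v : dot (gam j x) v = \sum_(k < d) w 0 k * dot (T j k x) v.
Proof.
rewrite /dot; under eq_bigr do rewrite gamE mulr_suml.
rewrite exchange_big /=; apply: eq_bigr => k _; rewrite mulr_sumr.
by apply: eq_bigr => i _; rewrite mulrA.
Qed.

Lemma sum_cauchy (I : finType) (a b : I -> R) :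
  (\sum_i a i * b i) ^+ 2 <= (\sum_i a i ^+ 2) * (\sum_i b i ^+ 2).
Proof.
have e (f : I -> R) : \sum_i f i = \sum_(k < #|I|) f (enum_val k).
  by rewrite (reindex (@enum_val I I)) //=; exists enum_rank => x _; [exact: enum_valK|exact: enum_rankK].
pose x : 'rV[R]_#|I| := \row_k a (enum_val k).
pose y : 'rV[R]_#|I| := \row_k b (enum_val k).
have xx : dot x x = \sum_i a i ^+ 2 by rewrite e; apply: eq_bigr => k _; rewrite !mxE expr2.
have yy : dot y y = \sum_i b i ^+ 2 by rewrite e; apply: eq_bigr => k _; rewrite !mxE expr2.
have xy : dot x y = \sum_i a i * b i by rewrite e; apply: eq_bigr => k _; rewrite !mxE.
have xy0 : 0 <= enorm x * enorm y by rewrite mulr_ge0 ?enorm_ge0.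
have := lerXn2r 2 (normr_ge0 _) xy0 (normr_dot_le x y).
by rewrite real_normK ?num_real// exprMn !sqr_enorm xx yy xy.
Qed.

(** Cauchy-Schwarz in the index contracted with [w], for each fixed pair of the other two. *)
Let gam_le y : \sum_(j < d) enorm (gam j y) ^+ 2 <= (enorm w * M) ^+ 2.
Proof.
rewrite exprMn; apply: le_trans (ler_wpM2l (sqr_ge0 _) (T_le y)).
rewrite mulr_sumr; apply: ler_sum => j _.
rewrite sqr_enorm /dot.
have -> : \sum_(k < d) enorm (T j k y) ^+ 2 = \sum_(i < d) \sum_(k < d) T j k y 0 i ^+ 2.
  rewrite exchange_big; apply: eq_bigr => k _; rewrite sqr_enorm.
  by apply: eq_bigr => i _; rewrite expr2.
rewrite mulr_sumr; apply: ler_sum => i _.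
rewrite -expr2 gamE (le_trans (sum_cauchy _ _))// sqr_enorm /dot.
by under [in leRHS]eq_bigr do rewrite -expr2.
Qed.

Let gam_le1 j y : enorm (gam j y) <= enorm w * M.
Proof.
rewrite -(@ler_pXn2r _ 2) ?nnegrE ?enorm_ge0 ?mulr_ge0 ?enorm_ge0//.
apply: le_trans (gam_le y); rewrite (bigD1 j)//= lerDl sumr_ge0// => i _.
exact: sqr_ge0.
Qed.

Let phi_line j x v (t : R) :
  is_derive t 1 (fun r => phi j (x + r *: v)) (dot (gam j (x + t *: v)) v).
Proof.
rewrite dot_gam /phi.
have -> : (fun r => \sum_(k < d) w 0 k * H j k (x + r *: v)) =
    \sum_(k < d) (fun r => w 0 k * H j k (x + r *: v)).
  by apply/funext => r; rewrite fct_sumE.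
exact: is_derive_sum.
Qed.

Let phi_lip j x y : `|phi j x - phi j y| <= enorm w * M * enorm (x - y).
Proof. exact: (lipschitz_of_line (phi_line j) (gam_le1 j)). Qed.

Let phi_grad j y (eta : R) : 0 < eta -> exists2 del : R, 0 < del &
  forall v, enorm v <= del ->
    `|phi j (y + v) - phi j y - dot (gam j y) v| <= eta * enorm v.
Proof.
move=> eta0; pose S := \sum_(k < d) `|w 0 k| + 1.
have S0 : 0 < S by rewrite ltr_wpDl// sumr_ge0.
have e0 : 0 < eta / S by rewrite divr_gt0.
have H1 k := H_grad j k y e0.
pose del k := projT1 (cid2 (H1 k)).
have del0 k : 0 < del k by rewrite /del; case: cid2.
have Hdel k v : enorm v <= del k ->
    `|H j k (y + v) - H j k y - dot (T j k y) v| <= eta / S * enorm v.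
  by rewrite /del; case: cid2 => /= ? _; apply.
exists (\big[Num.min/1]_(k < d) del k).
  by elim/big_ind: _ => // a b a0 b0; rewrite lt_min a0.
move=> v vd.
have vk k : enorm v <= del k by apply: le_trans vd _; exact: bigmin_le_cond.
rewrite dot_gam -!sumrB.
under eq_bigr do rewrite -!mulrBr.
rewrite (le_trans (ler_norm_sum _ _ _))//.
apply: (@le_trans _ _ (\sum_(k < d) `|w 0 k| * (eta / S * enorm v))).
  by apply: ler_sum => k _; rewrite normrM ler_wpM2l// Hdel.
rewrite -mulr_suml mulrA ler_wpM2r ?enorm_ge0// mulrCA ler_piMr ?(ltW eta0)//.
by rewrite ler_pdivrMr// mul1r lerDl.
Qed.

Lemma expect_grad_le z :
  expect (gaussW p s z) (fun x => dot (g x) w) - dot (g (wmean (gaussW p s z))) w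
  <= s ^+ 2 * (enorm w * M) * Num.sqrt d%:R.
Proof.
have W0 x : 0 < gaussW p s z x by exact: gaussW_gt0.
have Wm : forall x y,
  gaussW p s z x * gaussW p s z y * expR (enorm (x - y) ^+ 2 / (4 * s ^+ 2)) <=
  gaussW p s z (2^-1 *: (x + y)) ^+ 2 by move=> x y; exact: gaussW_mid.
have wM0 : 0 <= enorm w * M by rewrite mulr_ge0 ?enorm_ge0.
apply: (expect_taylor (rapid_gaussW p_gt0 p_growth s_gt0 z) W0 s_gt0 Wm wM0
  (h := fun x => dot (g x) w) _ _ phi_lip phi_grad gam_le).
- apply: scont_dot => i; [exact: (g_growth i).1|exact: scont_cst].
- move=> x v t.
  have -> : (fun r => dot (g (x + r *: v)) w) =
      \sum_(k < d) (fun r => w 0 k * g (x + r *: v) 0 k).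
    by apply/funext => r; rewrite fct_sumE; apply: eq_bigr => k _; rewrite mulrC.
  have -> : \sum_(j < d) phi j (x + t *: v) * v 0 j =
      \sum_(k < d) w 0 k * (\sum_(j < d) H j k (x + t *: v) * v 0 j).
    under eq_bigr do rewrite /phi mulr_suml.
    rewrite exchange_big /=; apply: eq_bigr => k _; rewrite mulr_sumr.
    by apply: eq_bigr => j _; rewrite mulrA.
  exact: is_derive_sum.
Qed.

End Direction.

Lemma grad_monotone x y : dot (g x - g y) (x - y) <= 0.
Proof.
have h a b : ln (p b) <= ln (p a) + dot (g a) (b - a).
  rewrite -[X in _ + X]expRK -lnM ?posrE ?expR_gt0// ler_ln ?posrE ?mulr_gt0 ?expR_gt0//.
have := h x y; have := h y x.
have -> : dot (g x) (y - x) = - dot (g x) (x - y) by rewrite -dotNr opprB.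
rewrite dotDl dotNl; lra.
Qed.

(** The test direction is the error [w = m - x0] itself. The choice of [z] makes
    [(m - z) / s ^ 2 = w / s ^ 2 + g x0], so monotonicity discards [dot (g m - g x0) w] and leaves
    [|w| ^ 2 / s ^ 2] on the left, to be divided by [|w|]. *)
Lemma mmse_map_bound x0 :
  enorm (mmse p s (x0 - s ^+ 2 *: g x0) - x0) <= s ^+ 4 * M * Num.sqrt d%:R.
Proof.
set z := x0 - _; rewrite mmse_wmean//; set m := wmean _; set w := m - x0.
have s2 : 0 < s ^+ 2 by rewrite exprn_gt0.
have h1 := expect_grad z w; have h2 := expect_grad_le w z.
have h3 := grad_monotone m x0.
have e1 : dot (m - z) w / s ^+ 2 = enorm w ^+ 2 / s ^+ 2 + dot (g x0) w.
  rewrite (_ : m - z = w + s ^+ 2 *: g x0); last by rewrite /w /z opprB addrCA addrC.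
  by rewrite dotDl dotZl sqr_enorm; field; rewrite gt_eqF.
rewrite h1 e1 -/m in h2.
have h4 : enorm w ^+ 2 / s ^+ 2 <= s ^+ 2 * (enorm w * M) * Num.sqrt d%:R.
  by move: h2 h3; rewrite -/w dotDl dotNl; lra.
have [->|n0] := eqVneq (enorm w) 0.
  by rewrite mulr_ge0 ?sqrtr_ge0// mulr_ge0// exprn_ge0 ?ltW.
have n1 : 0 < enorm w by rewrite lt0r n0 enorm_ge0.
move: h4; rewrite ler_pdivrMr// expr2.
have -> : s ^+ 2 * (enorm w * M) * Num.sqrt d%:R * s ^+ 2 =
  enorm w * (s ^+ 4 * M * Num.sqrt d%:R) by ring.
by rewrite ler_pM2l.
Qed.

End MapBound.

(** * Gradients and first-order expansions in the Euclidean norm *)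

Section Gradient.
Variables (R : realType) (d : nat).
Implicit Types (F : 'rV[R]_d -> R) (x v : 'rV[R]_d).

Definition grad F x : 'rV[R]_d := \row_i 'D_(evec R i) F x.

Lemma derive_grad F x v : differentiable F x -> 'D_v F x = dot (grad F x) v.
Proof.
move=> dF; rewrite deriveE// {1}[v]row_sum_delta linear_sum; apply: eq_bigr => i _.
by rewrite linearZ /= mxE deriveE// mulrC.
Qed.

Lemma derive_line F x v (t : R) : (forall y, differentiable F y) ->
  is_derive t 1 (fun r => F (x + r *: v)) (dot (grad F (x + t *: v)) v).
Proof.
move=> dF; rewrite -derive_grad//.
have E : (fun h : R => h^-1 *: (((fun r : R => F (x + r *: v)) \o shift t) (h *: 1)
      - F (x + t *: v))) =
   (fun h : R => h^-1 *: ((F \o shift (x + t *: v)) (h *: v) - F (x + t *: v))).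
  apply/funext => h /=; congr (_ *: (F _ - _)).
  by apply/rowP => i; rewrite !mxE /GRing.scale /= mulr1; ring.
have D := diff_derivable (dF (x + t *: v)) (v := v).
by apply: DeriveDef; rewrite ?/derivable ?/derive E.
Qed.

Lemma mxnorm_le_enorm v : `|v| <= enorm v.
Proof.
rewrite [X in X <= _]mx_normrE; apply/bigmax_leP; split; first exact: enorm_ge0.
by move=> [i j] _ /=; rewrite ord1 enorm_coord.
Qed.

Lemma differentiable_approx F x (eta : R) : differentiable F x -> 0 < eta ->
  exists2 del : R, 0 < del & forall v, enorm v <= del ->
    `|F (x + v) - F x - dot (grad F x) v| <= eta * enorm v.
Proof.
move=> dF eta0.
have := diff_locally dF => /eqaddoP /(_ _ eta0) /nbhs_ballP[del /= del0 H].
(* Halved because the ball is open while [enorm v] may equal the radius; the sup norm is at most the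
   Euclidean norm. *)
exists (del / 2) => [|v vd]; first by rewrite divr_gt0.
have vd' : ball 0 del v.
  rewrite -ball_normE /ball_ /= sub0r normrN (le_lt_trans (mxnorm_le_enorm v))//.
  by rewrite (le_lt_trans vd)// ltr_pdivrMr// ltr_pMr// ltr1n.
have Hv : `|F (v + x) - (F x + 'd F x v)| <= eta * `|v| := H v vd'.
rewrite -derive_grad// deriveE// [x + v]addrC -addrA -opprD (le_trans Hv)//.
apply: ler_wpM2l; first exact: ltW.
exact: mxnorm_le_enorm.
Qed.

Lemma differentiable_scont F : (forall x, differentiable F x) -> scont F.
Proof.
move=> dF u x /cvg_coord_enorm ux.
have [del del0 H] := differentiable_approx (dF x) ltr01.
pose K := 1 + enorm (grad F x).
have K0 : 0 < K by rewrite ltr_pwDl// enorm_ge0.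
apply/subr_cvg0/cvgr0Pnorm_le => e e0.
have m0 : 0 < Num.min del (e / K) by rewrite lt_min del0 divr_gt0.
move/cvgr0Pnorm_le : ux => /(_ _ m0); apply: filterS => n.
rewrite ger0_norm ?enorm_ge0// le_min => /andP[ud ue].
have := H _ ud; rewrite [x + _]addrC subrK mul1r => Hn.
rewrite ler_pdivlMr// in ue; apply: le_trans ue.
rewrite -[F (u n) - F x](subrK (dot (grad F x) (u n - x))).
rewrite (le_trans (ler_normD _ _))// mulrC /K mulrDl mul1r lerD//.
exact: normr_dot_le.
Qed.

End Gradient.

(** * Derivatives of the logarithm of the density *)

Section LogDerivatives.
Variables (R : realType) (d : nat) (p : 'rV[R]_d -> R).
Hypothesis p_gt0 : forall x, 0 < p x.
Hypothesis p_C3 : thrice_differentiable p.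
Local Notation L := ((@ln R) \o p).

Let dp x : differentiable p x. Proof. by case: p_C3. Qed.
Let dp1 i x : differentiable ('D_(evec R i) p) x. Proof. by case: p_C3. Qed.
Let dp2 i j x : differentiable ('D_(evec R i) ('D_(evec R j) p)) x. Proof. by case: p_C3. Qed.

Let dV x : differentiable (fun y => (p y)^-1) x.
Proof. by apply: differentiableV => //; rewrite gt_eqF. Qed.

Let dln (x : R) : 0 < x -> differentiable (@ln R) x.
Proof. by move=> x0; apply/derivable1_diffP; have [] := is_derive1_ln x0. Qed.

Lemma differentiable_lnp x : differentiable L x.
Proof. by apply: differentiable_comp => //; exact: dln. Qed.

Lemma derive_lnp v : 'D_v L = (fun x => (p x)^-1) * 'D_v p.
Proof.
apply/funext => x; rewrite deriveE; last exact: differentiable_lnp.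
rewrite diff_comp//=; last exact: dln.
rewrite diff1E; last exact: dln.
by rewrite derive1E; have [_ ->] := is_derive1_ln (p_gt0 x); rewrite -deriveE// mulrC.
Qed.

Lemma differentiable_lnp1 k x : differentiable ('D_(evec R k) L) x.
Proof. by rewrite derive_lnp; exact: differentiableM. Qed.

Lemma derive_lnp2 j k : 'D_(evec R j) ('D_(evec R k) L) =
  (fun x => (p x)^-1) * 'D_(evec R j) ('D_(evec R k) p) +
  'D_(evec R k) p * ((fun x => - (p x) ^- 2) * 'D_(evec R j) p).
Proof.
apply/funext => x; rewrite derive_lnp deriveM; [|exact: diff_derivable..].
by rewrite deriveV ?gt_eqF//; exact: diff_derivable.
Qed.

Lemma differentiable_lnp2 j k x : differentiable ('D_(evec R j) ('D_(evec R k) L)) x.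
Proof.
rewrite derive_lnp2; apply: differentiableD; apply: differentiableM => //.
apply: differentiableM => //; apply: differentiableN.
apply: differentiableV; first exact: (differentiableM (dp x) (dp x)).
by rewrite expf_neq0// gt_eqF.
Qed.

End LogDerivatives.

(** * Log-concave densities, the proximal point and the iteration *)

Section LogConcave.
Variables (R : realType) (d : nat) (p : 'rV[R]_d -> R).
Hypothesis p_gt0 : forall x, 0 < p x.
Hypothesis p_logconcave : log_concave p.
Hypothesis p_C3 : thrice_differentiable p.
Hypothesis M_finite : has_ubound (range (frob3_lnp p)).
Local Notation L := ((@ln R) \o p).
Local Notation g := (grad L).
Local Notation M := (sup (range (frob3_lnp p))).

(** Concavity on the segment, at a small [t] where the first-order expansion has slope error [eta],
    is divided by [t]; then [eta] tends to 0. *)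
Lemma lnp_tangent x y : ln (p y) <= ln (p x) + dot (g x) (y - x).
Proof.
set v := y - x.
have step (eta : R) : 0 < eta -> ln (p y) <= ln (p x) + dot (g x) v + eta * enorm v.
  move=> eta0.
  have [del del0 H] := differentiable_approx (differentiable_lnp p_gt0 p_C3 x) eta0.
  pose t := Num.min 1 (del / (enorm v + 1)).
  have ev1 : 0 < enorm v + 1 by rewrite ltr_wpDl ?enorm_ge0.
  have t0 : 0 < t by rewrite lt_min ltr01 divr_gt0.
  have t1 : t <= 1 by rewrite ge_min lexx.
  have tv : enorm (t *: v) <= del.
    rewrite enormZ gtr0_norm//; apply: (@le_trans _ _ (del / (enorm v + 1) * enorm v)).
      by rewrite ler_wpM2r ?enorm_ge0// ge_min lexx orbT.
    by rewrite -mulrA ler_piMr ?(ltW del0)// mulrC ler_pdivrMr// mul1r lerDl.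
  have /ler_normlP[_] := H _ tv; rewrite /= enormZ gtr0_norm// dotZr => Hv.
  have tt : 0 <= t <= 1 by rewrite (ltW t0).
  have := p_logconcave y x tt.
  rewrite (_ : t *: y + (1 - t) *: x = x + t *: v); last first.
    by apply/rowP => i; rewrite !mxE; ring.
  move=> C; rewrite -(ler_pM2l t0); lra.
apply/ler_addgt0Pr => e e0.
have ev1 : 0 < enorm v + 1 by rewrite ltr_wpDl ?enorm_ge0.
apply: le_trans (step (e / (enorm v + 1)) (divr_gt0 e0 ev1)) _; rewrite lerD2l.
by rewrite -mulrA ler_piMr ?(ltW e0)// mulrC ler_pdivrMr// mul1r lerDl.
Qed.

Lemma logconcave_tangent x y : p y <= p x * expR (dot (g x) (y - x)).
Proof.
rewrite -ler_ln ?posrE ?mulr_gt0 ?expR_gt0// lnM ?posrE ?expR_gt0// expRK.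
exact: lnp_tangent.
Qed.

Lemma logconcave_growth : egrowth p.
Proof.
split; first by apply: differentiable_scont; case: p_C3.
exists (p 0), (enorm (g 0)); split=> [|x]; first exact: enorm_ge0.
rewrite gtr0_norm// (le_trans (logconcave_tangent 0 x))// subr0 ler_wpM2l ?(ltW (p_gt0 _))//.
rewrite ler_expR (le_trans (dot_le _ _))// ler_wpM2l ?enorm_ge0//.
exact: enorm_le_norm1.
Qed.

Lemma logconcave_mid x y : p x * p y <= p (2^-1 *: (x + y)) ^+ 2.
Proof.
have t01 : (0 <= (2^-1 : R)) && ((2^-1 : R) <= 1) by apply/andP; split; lra.
have := p_logconcave x y t01.
rewrite (_ : 1 - 2^-1 = 2^-1 :> R); last by field.
rewrite -(scalerDr 2^-1 x y) => H.
rewrite -ler_ln ?posrE ?mulr_gt0 ?exprn_gt0// lnM ?posrE// lnXn// mulr2n; lra.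
Qed.

Let H j k : 'rV[R]_d -> R := 'D_(evec R j) ('D_(evec R k) L).
Let T j k : 'rV[R]_d -> 'rV[R]_d := grad (H j k).

Let M_ge0 : 0 <= M.
Proof.
apply: (@le_trans _ _ (frob3_lnp p 0)); first exact: sqrtr_ge0.
by apply: ub_le_sup => //; exists 0.
Qed.

(** The outermost index of [D3] is the gradient index of [T j k], so this is a mere reordering of
    sums, without symmetry of mixed partials. *)
Let T_le y : \sum_(j < d) \sum_(k < d) enorm (T j k y) ^+ 2 <= M ^+ 2.
Proof.
have F0 : 0 <= frob3_lnp p y by exact: sqrtr_ge0.
have FM : frob3_lnp p y <= M by apply: ub_le_sup => //; exists y.
apply: le_trans (lerXn2r 2 F0 M_ge0 FM).
rewrite /frob3_lnp sqr_sqrtr; last first.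
  by do 3 (apply: sumr_ge0 => ? _); exact: sqr_ge0.
rewrite exchange_big /= [leRHS]exchange_big /= exchange_big /=.
apply: ler_sum => j _; rewrite [leRHS]exchange_big /=; apply: ler_sum => k _.
rewrite sqr_enorm; apply: ler_sum => i _.
by rewrite /T !mxE expr2.
Qed.

Let sum_term_le (F : 'I_d -> R) i : (forall j, 0 <= F j) -> F i <= \sum_(j < d) F j.
Proof. by move=> F0; rewrite (bigD1 i)//= lerDl sumr_ge0. Qed.

Let T_le1 j k y : enorm (T j k y) <= M.
Proof.
rewrite -(@ler_pXn2r _ 2) ?nnegrE ?enorm_ge0//.
pose F j k := enorm (T j k y) ^+ 2.
have F0 i l : 0 <= F i l by exact: sqr_ge0.
apply: le_trans (T_le y); apply: (@le_trans _ _ (\sum_(l < d) F j l)).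
  exact: (sum_term_le k (F0 j)).
have S0 i : 0 <= \sum_(l < d) F i l by exact: sumr_ge0.
exact: (sum_term_le j S0).
Qed.

Let H_line j k x v (t : R) :
  is_derive t 1 (fun r => H j k (x + r *: v)) (dot (T j k (x + t *: v)) v).
Proof. by apply: derive_line => z; exact: differentiable_lnp2. Qed.

Let g_line k x v (t : R) :
  is_derive t 1 (fun r => g (x + r *: v) 0 k) (\sum_(j < d) H j k (x + t *: v) * v 0 j).
Proof.
have D := derive_line x v t (differentiable_lnp1 p_gt0 p_C3 k).
rewrite (_ : (fun r => g (x + r *: v) 0 k) = (fun r => 'D_(evec R k) L (x + r *: v))).
  by apply: is_derive_eq; apply: eq_bigr => j _; rewrite mxE.
by apply/funext => r; rewrite mxE.
Qed.

Let g_growth k : egrowth (fun x => g x 0 k).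
Proof.
apply: (egrowth_of_line (phi := fun j => H j k) M_ge0).
- have c := differentiable_scont (differentiable_lnp1 p_gt0 p_C3 k).
  rewrite (_ : (fun x => g x 0 k) = 'D_(evec R k) L)//.
  by apply/funext => r; rewrite mxE.
- exact: g_line.
- by move=> j; exact: (lipschitz_of_line (H_line j k) (T_le1 j k)).
Qed.

Lemma logconcave_map_bound (s : R) x0 : 0 < s ->
  enorm (mmse p s (x0 - s ^+ 2 *: g x0) - x0) <= s ^+ 4 * M * Num.sqrt d%:R.
Proof.
move=> s0; apply: (mmse_map_bound p_gt0 logconcave_growth logconcave_mid s0
  logconcave_tangent g_growth M_ge0 g_line H_line _ T_le).
by move=> j k z eta; apply: differentiable_approx; exact: differentiable_lnp2.
Qed.

Lemma prox_grad (tau : R) y xs : 0 < tau -> is_prox p tau y xs -> y - xs = - tau *: g xs.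
Proof.
move=> tau0 Hp; set u := y - xs + tau *: g xs.
suff /enorm0_eq u0 : enorm u = 0.
  by apply/eqP; rewrite scaleNr -addr_eq0 -/u u0.
apply/eqP; apply: contraT => n0.
have n1 : 0 < enorm u by rewrite lt0r n0 enorm_ge0.
(* Moving by [t u] gains [t |u| ^ 2] to first order. This slack costs [t |u| ^ 2 / 4] and the
   quadratic term at most [t |u| ^ 2 / 2], so the objective would drop strictly. *)
have e0 : 0 < enorm u / (4 * tau) by rewrite divr_gt0// mulr_gt0.
have [del del0 Hd] := differentiable_approx (differentiable_lnp p_gt0 p_C3 xs) e0.
pose t := Num.min 1 (del / enorm u).
have t0 : 0 < t by rewrite lt_min ltr01 divr_gt0.
have t1 : t <= 1 by rewrite ge_min lexx.
have tu : enorm (t *: u) <= del.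
  by rewrite enormZ gtr0_norm// -ler_pdivlMr// ge_min lexx orbT.
have /ler_normlP[+ _] := Hd _ tu; rewrite /= enormZ gtr0_norm// dotZr => Hv.
have := Hp (xs + t *: u).
have -> : enorm (y - (xs + t *: u)) ^+ 2 =
    enorm (y - xs) ^+ 2 - 2 * t * dot (y - xs) u + t ^+ 2 * enorm u ^+ 2.
  rewrite opprD addrA; move: (y - xs) (u) => w v.
  by rewrite !sqr_enorm !dotE (dotC v w); ring.
move=> Hq.
have uu : dot (y - xs) u + tau * dot (g xs) u = enorm u ^+ 2.
  by rewrite sqr_enorm {2}/u [RHS]dotDl dotZl.
have Hw : tau * (ln (p xs) - ln (p (xs + t *: u)) + t * dot (g xs) u)
    <= 4^-1 * t * enorm u ^+ 2.
  have -> : 4^-1 * t * enorm u ^+ 2 = tau * (enorm u / (4 * tau) * (t * enorm u)).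
    by field; rewrite gt_eqF.
  rewrite ler_pM2l//; lra.
have u2 : 0 < t * enorm u ^+ 2 by rewrite mulr_gt0// exprn_gt0.
have t2 : t ^+ 2 * enorm u ^+ 2 <= t * enorm u ^+ 2.
  by rewrite ler_wpM2r ?sqr_ge0// expr2 ler_piMl// ltW.
have uut : t * dot (y - xs) u + t * (tau * dot (g xs) u) = t * enorm u ^+ 2.
  by rewrite -mulrDr uu.
by exfalso; lra.
Qed.

Section Iteration.
Variables (tau : R) (y xs : 'rV[R]_d).
Hypothesis tau_gt0 : 0 < tau.
Hypothesis xs_prox : is_prox p tau y xs.
Let B := tau ^+ 2 * M * Num.sqrt d%:R.
Let z (k : nat) : 'rV[R]_d := xs + k.+1%:R^-1 *: (y - xs).

(* [z k] is fixed by the iteration once the posterior mean is replaced by [xs], and it is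
   the point whose posterior mode is [xs]. *)
Lemma iterate_anchor k :
  k.+1%:R * enorm (iterate p tau y k - z k) <= (\sum_(j < k) j.+1%:R^-1) * B.
Proof.
elim: k => [|k IH].
  rewrite big_ord0 mul0r mul1r /= /z invr1 scale1r [xs + _]addrC subrK subrr.
  by rewrite -(scale0r (0 : 'rV[R]_d)) enormZ normr0 mul0r.
set x := iterate p tau y k; set s := sigma tau k.
have k1 : 0 < k.+1%:R :> R by rewrite ltr0n.
have k2 : 0 < k.+2%:R :> R by rewrite ltr0n.
have s2 : s ^+ 2 = tau / k.+1%:R by rewrite /s /sigma sqr_sqrtr// divr_ge0// ltW.
have s0 : 0 < s by rewrite /s /sigma sqrtr_gt0 divr_gt0.
have zk : z k = xs - s ^+ 2 *: g xs.
  by rewrite /z (prox_grad tau_gt0 xs_prox) scalerA s2 mulrN scaleNr mulrC.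
have step : iterate p tau y k.+1 - z k.+1 = alpha R k *: (mmse p s x - xs).
  have e2 : k.+2%:R = k.+1%:R + 1 :> R by rewrite natr1.
  rewrite /= -/x -/s /z /alpha e2; move: (mmse p s x) (k.+1%:R : R) k1 => mm K K0.
  by apply/rowP => i; rewrite !mxE; field; rewrite gt_eqF// addr_gt0.
(* The weight [k + 1] in the statement is chosen for this: it turns the contraction by [alpha k]
   into a telescoping recursion. *)
have ak : k.+2%:R * alpha R k = k.+1%:R by rewrite /alpha mulrC divfK// gt_eqF.
rewrite step enormZ ger0_norm; last by rewrite divr_ge0.
rewrite mulrA ak big_ord_recr /= mulrDl.
have tri : enorm (mmse p s x - xs) <= enorm (x - z k) + s ^+ 4 * M * Num.sqrt d%:R.
  rewrite (_ : mmse p s x - xs = (mmse p s x - mmse p s (z k)) + (mmse p s (z k) - xs)); last first.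
    by rewrite addrA subrK.
  rewrite (le_trans (enormD _ _))// lerD//.
    exact: (mmse_nonexpansive p_gt0 logconcave_growth logconcave_mid s0).
  by rewrite zk logconcave_map_bound.
apply: le_trans (ler_wpM2l (ltW k1) tri) _; rewrite mulrDr lerD//.
(* [(k + 1) s ^ 4 = tau ^ 2 / (k + 1)], so step [k] contributes the harmonic term [B / (k + 1)]. *)
rewrite (_ : s ^+ 4 = (s ^+ 2) ^+ 2); last by rewrite -exprM.
rewrite s2 /B le_eqVlt; apply/orP; left; apply/eqP.
by field; rewrite gt_eqF.
Qed.

(** Inductive step: [ln (1 - 1 / (k + 2)) <= - 1 / (k + 2)]. *)
Lemma harmonic_le_ln (k : nat) : (0 < k)%N -> \sum_(j < k) j.+1%:R^-1 <= 1 + ln k%:R :> R.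
Proof.
elim: k => // -[|k] IH _; first by rewrite big_ord1 invr1 ln1 addr0.
rewrite big_ord_recr /= (le_trans (lerD (IH isT) (lexx _)))// -addrA lerD2l.
have k1 : 0 < k.+1%:R :> R by rewrite ltr0n.
have k2 : 0 < k.+2%:R :> R by rewrite ltr0n.
have u0 : 0 < k.+1%:R / k.+2%:R :> R by rewrite divr_gt0.
have e : k.+1%:R / k.+2%:R = 1 - k.+2%:R^-1 :> R.
  have e2 : k.+2%:R = k.+1%:R + 1 :> R by rewrite natr1.
  by rewrite e2; move: (k.+1%:R : R) k1 => K K0; field; rewrite gt_eqF// addr_gt0.
have h : - 1 < - k.+2%:R^-1 :> R by rewrite ltrN2 invf_lt1// ltr1n.
have := le_ln1Dx h; rewrite -e ln_div ?posrE//.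
by move: (ln k.+1%:R) (ln k.+2%:R) (k.+2%:R^-1) => a b c; lra.
Qed.

(** Multiplied by [k + 1], the two distances through [z k] give [(1 + ln k) * B + |y - xs|], which
    the constant 7 covers with room to spare. *)
Lemma iterate_bound k : (0 < k)%N ->
  enorm (iterate p tau y k - xs) <= (ln k%:R + 7) / k.+1%:R * (enorm (y - xs) + B).
Proof.
move=> k0; have k1 : 0 < k.+1%:R :> R by rewrite ltr0n.
have B0 : 0 <= B by rewrite mulr_ge0 ?sqrtr_ge0// mulr_ge0 ?sqr_ge0.
have l0 : 0 <= ln k%:R :> R by rewrite ln_ge0// ler1n.
have y0 := enorm_ge0 (y - xs).
rewrite -(ler_pM2l k1).
have -> : k.+1%:R * ((ln k%:R + 7) / k.+1%:R * (enorm (y - xs) + B)) =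
  (ln k%:R + 7) * (enorm (y - xs) + B) by field; rewrite gt_eqF.
have tri : enorm (iterate p tau y k - xs) <=
    enorm (iterate p tau y k - z k) + k.+1%:R^-1 * enorm (y - xs).
  rewrite -[k.+1%:R^-1 in leRHS]ger0_norm ?invr_ge0// -enormZ.
  apply: le_trans (enormD _ _); rewrite le_eqVlt; apply/orP; left; apply/eqP.
  by congr enorm; rewrite /z opprD addrA subrK.
apply: le_trans (ler_wpM2l (ltW k1) tri) _.
rewrite mulrDr mulrA divff ?gt_eqF// mul1r.
have h1 := le_trans (iterate_anchor k) (ler_wpM2r B0 (harmonic_le_ln k0)).
have h2 : 0 <= ln k%:R * enorm (y - xs) by rewrite mulr_ge0.
lra.
Qed.

End Iteration.
End LogConcave.

Theorem theorem1 (R : realType) (d : nat) (p : 'rV[R]_d -> R)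
  (p_pos : forall x, 0 < p x)
  (p_density : iintE p = 1%E)
  (p_logconcave : log_concave p)
  (p_C3 : thrice_differentiable p)
  (M_finite : has_ubound (range (frob3_lnp p)))
  (tau : R) (tau_pos : 0 < tau) (y xstar : 'rV[R]_d)
  (xstar_prox : is_prox p tau y xstar) :
  forall k : nat, (1 <= k)%N ->
    enorm (iterate p tau y k - xstar)
    <= (ln k%:R + 7) / k.+1%:R
       * (enorm (y - xstar)
          + tau ^+ 2 * sup (range (frob3_lnp p)) * Num.sqrt d%:R).
Proof. by move=> k k_gt0; exact: iterate_bound. Qed.
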